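(* Assume the setting described in the context, where $(X_i,Y_i)_{i=1}^n$ is stationary $\beta$-mixing with coefficients $\beta(\cdot)$. Let $\alpha\in(0,1)$, $\delta_{\mathrm{cal}}>0$, $\delta_{\mathrm{test}}>0$, and define $\widetilde{\sigma}(a)=\sqrt{\frac14+\frac{2}{a}\sum_{j=1}^{a-1}(a-j)\beta(j)}$, \[\varepsilon_{\mathrm{cal}}=\inf_{(a,m,r)\in F_{\mathrm{cal}}}\left\{\widetilde{\sigma}(a)\sqrt{\frac{4}{n_{\mathrm{cal}}-r+1}\log\left(\frac{4}{\delta_{\mathrm{cal}}-4(m-1)\beta(a)-\beta(r)}\right)}+\frac{1}{3m}\log\left(\frac{4}{\delta_{\mathrm{cal}}-4(m-1)\beta(a)-\beta(r)}\right)+\frac{r-1}{n_{\mathrm{cal}}}\right\},\] with $F_{\mathrm{cal}}=\{(a,m,r)\in\mathbb{N}_{>0}^3: 2ma=n_{\mathrm{cal}}-r+1,\ \delta_{\mathrm{cal}}>4(m-1)\beta(a)+\beta(r)\}$, and \[\varepsilon_{\mathrm{test}}=\inf_{(a,m,s)\in F_{\mathrm{test}}}\left\{\widetilde{\sigma}(a)\sqrt{\frac{4}{n_{\mathrm{test}}}\log\left(\frac{4}{\delta_{\mathrm{test}}-4(m-1)\beta(a)-\beta(n_{\mathrm{cal}})}\right)}+\frac{1}{3m}\log\left(\frac{4}{\delta_{\mathrm{test}}-4(m-1)\beta(a)-\beta(n_{\mathrm{cal}})}\right)+\frac{s}{n_{\mathrm{test}}}\right\},\] with $F_{\mathrm{test}}=\{(a,m,s)\in\mathbb{N}_{>0}^2\times\mathbb{N}: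 2ma=n_{\mathrm{test}}-s,\ \delta_{\mathrm{test}}>4(m-1)\beta(a)+\beta(n_{\mathrm{cal}})\}$. Let $\eta=\varepsilon_{\mathrm{cal}}+\varepsilon_{\mathrm{test}}$. Then \[\mathbb{P}\left[\frac{1}{n_{\mathrm{test}}}\sum_{i\in I_{\mathrm{test}}}\mathbf{1}\{Y_i\in C_{1-\alpha}(X_i)\}\ge 1-\alpha-\eta\right]\ge 1-\delta_{\mathrm{cal}}-\delta_{\mathrm{test}}.\] Additionally, if $\widehat{s}_{\mathrm{train}}(X_*,Y_* )$ almost surely has a continuous distribution conditionally on the training data, then \[\mathbb{P}\left[\left|\frac{1}{n_{\mathrm{test}}}\sum_{i\in I_{\mathrm{test}}}\mathbf{1}\{Y_i\in C_{1-\alpha}(X_i)\}-(1-\alpha)\right|\le\eta\right]\ge 1-2\delta_{\mathrm{cal}}-2\delta_{\mathrm{test}}.\]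
   Context: Let $\mathcal{X},\mathcal{Y}$ be measurable spaces. A stochastic process $\{Z_t\}_{t\in\mathbb{Z}}$ is stationary if its finite-dimensional distributions are shift-invariant; its $\beta$-mixing coefficient at $a\in\mathbb{N}$ is $\beta(a)=\|\mathbb{P}_{-\infty:0,a:\infty}-\mathbb{P}_{-\infty:0}\otimes\mathbb{P}_{a:\infty}\|_{\mathrm{TV}}$ (total variation distance between the joint law of the blocks $(Z_{-\infty:0},Z_{a:\infty})$ and the product of their laws), and the process is $\beta$-mixing if $\beta(a)\to0$. ''The sample $(X_i,Y_i)_{i=1}^n$ is stationary $\beta$-mixing'' means $(X_i,Y_i)=Z_i$, $i=1,\dots,n$, for such a process with values in $\mathcal{X}\times\mathcal{Y}$. Let $(X_*,Y_* )$ be independent of the sample with $(X_*,Y_* )\sim(X_1,Y_1)$. Write $n=n_{\mathrm{train}}+n_{\mathrm{cal}}+n_{\mathrm{test}}$ with positive integers, $I_{\mathrm{train}}=\{1,\dots,n_{\mathrm{train}}\}$, $I_{\mathrm{cal}}=\{n_{\mathrm{train}}+1,\dots,n_{\mathrm{train}}+n_{\mathrm{cal}}\}$, $I_{\mathrm{test}}=\{n_{\mathrm{train}}+n_{\mathrm{cal}}+1,\dots,n\}$. Let $s:(\mathcal{X}\times\mathcal{Y})^{n_{\mathrm{train}}+1}\to\mathbb{R}$ be any (measurable) function and $\widehat{s}_{\mathrm{train}}(x,y)=s((X_i,Y_i)_{i\in I_{\mathrm{train}}},(x,y))$. For $\phi\in[0,1)$, $\widehat{q}_{\phi,\mathrm{cal}}=\inf\{t\in\mathbb{R}:\frac{1}{n_{\mathrm{cal}}}\sum_{i\in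 I_{\mathrm{cal}}}\mathbf{1}\{\widehat{s}_{\mathrm{train}}(X_i,Y_i)\le t\}\ge\phi\}$ and $C_\phi(x)=\{y\in\mathcal{Y}:\widehat{s}_{\mathrm{train}}(x,y)\le\widehat{q}_{\phi,\mathrm{cal}}\}$. An infimum over the empty set is $+\infty$. *)

(* Defs.v *)
From HB Require Import structures.
From mathcomp Require Import all_boot all_order all_algebra.
From mathcomp Require Import all_classical all_reals all_analysis.
Set Implicit Arguments.
Unset Strict Implicit.
Unset Printing Implicit Defensive.
Import Order.TTheory GRing.Theory Num.Theory.
Local Open Scope classical_set_scope.
Local Open Scope ring_scope.

Section seqspace.
Context {dT : measure_display} (T : measurableType dT).

Definition coord_sets : set (set (nat -> T)) :=
  \bigcup_(k in [set: nat]) preimage_set_system setT (fun f : nat -> T => f k) measurable.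

Definition seqspace := g_sigma_algebraType coord_sets.
End seqspace.

Section process.
Context {R : realType} {d : measure_display} {Omega : measurableType d}
  (P : probability Omega R) {dT : measure_display} {T : measurableType dT}.
Local Open Scope ereal_scope.

Definition past_block (Z : int -> Omega -> T) (w : Omega) : seqspace T :=
  fun k : nat => Z (- (k%:Z))%R w.
Definition future_block (Z : int -> Omega -> T) (a : nat) (w : Omega) : seqspace T :=
  fun k : nat => Z (a%:Z + k%:Z)%R w.

Definition stationary (Z : int -> Omega -> T) : Prop :=
  forall (k : nat) (t : k.-tuple int) (h : int) (A : set (k.-tuple T)),
    measurable A ->
    P [set w | A [tuple Z (tnth t i + h)%R w | i < k]] =
    P [set w | A [tuple Z (tnth t i) w | i < k]].

(* beta(a) = || P_{-oo:0, a:oo} - P_{-oo:0} (x) P_{a:oo} ||_TV,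
   with ||mu - nu||_TV = sup_A |mu A - nu A| over measurable A *)
Definition beta_coef (Z : int -> Omega -> T) (a : nat) : R :=
  fine (ereal_sup
    [set `| pushforward P (fun w => (past_block Z w, future_block Z a w)) A
           - ((pushforward P (past_block Z)) \x (pushforward P (future_block Z a))) A |
     | A in [set A : set (seqspace T * seqspace T) | measurable A]]).

Definition beta_mixing (Z : int -> Omega -> T) : Prop :=
  (beta_coef Z a @[a --> \oo] --> 0%R)%R.
End process.

Section epsilons.
Context {R : realType}.

Definition sigma_tilde (beta : nat -> R) (a : nat) : R :=
  Num.sqrt (1 / 4 + 2 / a%:R * \sum_(1 <= j < a) (a - j)%:R * beta j).

Definition Lcal (beta : nat -> R) (delta : R) (a m r : nat) : R :=
  ln (4 / (delta - 4 * (m - 1)%:R * beta a - beta r)).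

Definition F_cal (beta : nat -> R) (ncal : nat) (delta : R) (a m r : nat) : Prop :=
  [/\ (0 < a)%N, (0 < m)%N, (0 < r)%N,
      (2 * m * a = ncal - r + 1)%N & 4 * (m - 1)%:R * beta a + beta r < delta].

Definition eps_cal (beta : nat -> R) (ncal : nat) (delta : R) : \bar R :=
  ereal_inf [set v : \bar R | exists a m r : nat, F_cal beta ncal delta a m r /\
     v = (sigma_tilde beta a
            * Num.sqrt (4 / (ncal - r + 1)%:R * Lcal beta delta a m r)
          + 1 / (3 * m%:R) * Lcal beta delta a m r
          + (r - 1)%:R / ncal%:R)%:E].

Definition F_test (beta : nat -> R) (ncal ntest : nat) (delta : R) (a m s : nat) : Prop :=
  [/\ (0 < a)%N, (0 < m)%N,
      (2 * m * a = ntest - s)%N & 4 * (m - 1)%:R * beta a + beta ncal < delta].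

Definition eps_test (beta : nat -> R) (ncal ntest : nat) (delta : R) : \bar R :=
  ereal_inf [set v : \bar R | exists a m s : nat, F_test beta ncal ntest delta a m s /\
     v = (sigma_tilde beta a
            * Num.sqrt (4 / ntest%:R * Lcal beta delta a m ncal)
          + 1 / (3 * m%:R) * Lcal beta delta a m ncal
          + s%:R / ntest%:R)%:E].
End epsilons.

Section conformal.
Context {R : realType} {d : measure_display} {Omega : measurableType d}
  {d1 d2 : measure_display} {X : measurableType d1} {Y : measurableType d2}.
Variables (Z : int -> Omega -> X * Y) (ntr ncal ntest : nat)
  (s : ntr.-tuple (X * Y) -> X * Y -> R).

(* (X_i,Y_i) = Z_i, i = 1..n, with n = ntr + ncal + ntest *)
Definition train_data (w : Omega) : ntr.-tuple (X * Y) :=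
  [tuple Z (Posz i.+1) w | i < ntr].

Definition s_train (w : Omega) (z : X * Y) : R := s (train_data w) z.

(* I_cal = {ntr+1, ..., ntr+ncal}; I_test = {ntr+ncal+1, ..., n} *)
Definition Zcal (i : nat) (w : Omega) : X * Y := Z (Posz (ntr + i.+1)) w.
Definition Ztest (i : nat) (w : Omega) : X * Y := Z (Posz (ntr + ncal + i.+1)) w.

Definition q_cal (phi : R) (w : Omega) : \bar R :=
  ereal_inf [set t%:E | t in [set t : R |
     phi <= ncal%:R^-1 * \sum_(i < ncal) (s_train w (Zcal i w) <= t)%R%:R]].

Definition conf_set (phi : R) (w : Omega) (x : X) : set Y :=
  [set y | (s_train w (x, y))%:E <= q_cal phi w]%E.

Definition test_coverage (phi : R) (w : Omega) : R :=
  ntest%:R^-1 * \sum_(i < ntest) ((Ztest i w).2 \in conf_set phi w (Ztest i w).1)%:R.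
End conformal.
Arguments s_train {R d Omega d1 d2 X Y} Z ntr s w z.
Arguments q_cal {R d Omega d1 d2 X Y} Z ntr ncal s phi w.
Arguments conf_set {R d Omega d1 d2 X Y} Z ntr ncal s phi w x _.
Arguments test_coverage {R d Omega d1 d2 X Y} Z ntr ncal ntest s phi w.

(* Main.v *)
Require Import Defs.
From HB Require Import structures.
From mathcomp Require Import all_boot all_order all_algebra.
From mathcomp Require Import all_classical all_reals all_analysis.
From mathcomp Require Import measurable_realfun.
From mathcomp Require Import ring lra zify.
Import Order.TTheory GRing.Theory Num.Theory numFieldNormedType.Exports.
Local Open Scope classical_set_scope.
Local Open Scope ring_scope.

Set Implicit Arguments.
Unset Strict Implicit.
Unset Printing Implicit Defensive.

(** Conditionally on the training block (at the cost [beta r], resp.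
    [beta ncal]), calibration and test frequencies of a score set are averages
    of indicators of a fixed set. Cutting them into [2 m] blocks of length [a]
    and replacing the blocks of the same parity by independent copies costs
    [(m - 1) beta a] for each parity; the block variance is at most
    [a * sigma_tilde a ^ 2] and Bernstein's inequality applies. The random
    calibration quantile is then compared with population quantiles of the
    trained score at the levels [1 - alpha -/+ eps_cal], which are functions of
    the training data only, so that the test frequencies below these quantiles
    concentrate as well. *)

(** * A sub-gamma Chernoff bound *)

(** Independent copies are never built on a larger space. Only the number of hits of a set matters,
    and it depends on finitely many bits, so replacing a block is an inequality between finite sums,
    and [m] independent blocks are [m] iterations of an expectation operator. The price [beta a] of
    a replacement is valid for functions with values in [0,1]; exponentials are unbounded, so the
    indicator of the deviation is decoupled first and majorised by an exponential afterwards. The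
    conformal set depends on the calibration data, which touch the test data, so no gap separates
    them. Quantiles frozen by the training data remove this obstacle: the calibration block itself
    becomes the gap before the test block. The 4 in the logarithms leaves room for two parities and
    two tails; every bound used is one-sided and spends half of it. *)

Section bernstein_real.
Variable R : realType.
Implicit Types x b c t L : R.

Lemma nondecr_of_derive (f df : R -> R) :
  (forall x, is_derive x (1 : R) f (df x)) -> (forall x, 0 <= df x) ->
  {homo f : x y / x <= y}.
Proof.
move=> dff df0 x y; rewrite le_eqVlt => /predU1P[->//|xy].
have cf : {within `[x, y], continuous f}.
  apply: continuous_subspaceT => z.
  by apply: differentiable_continuous; apply/derivable1_diffP; have := dff z.
have [z _ e] := MVT xy (fun z _ => dff z) cf.
by rewrite -subr_ge0 e mulr_ge0// subr_ge0 ltW.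
Qed.

Let h x : R := 6 + 4 * x + x ^+ 2 - expR x * (6 - 2 * x).
Let h' x : R := 4 + 2 * x - expR x * (4 - 2 * x).

(** The [2/1] Padé approximant of [expR] at 0, cleared of its denominator so that it holds for all
    [x]. The difference [h] and its derivative [h'] vanish at 0, and [h'] is nondecreasing because
    [expR z * (1 - z) <= expR z * expR (- z) = 1]. *)
Lemma expR_pade x : expR x * (6 - 2 * x) <= 6 + 4 * x + x ^+ 2.
Proof.
rewrite -subr_ge0 -/(h x).
have dh' z : is_derive z (1 : R) h' (2 - 2 * (expR z * (1 - z))).
  apply: is_derive_eq; rewrite /GRing.scale /=; ring.
have dh z : is_derive z (1 : R) h (h' z).
  by apply: is_derive_eq; rewrite /h' /GRing.scale /=; ring.
have mh' : {homo h' : x y / x <= y}.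
  apply: (nondecr_of_derive dh') => z.
  have e0 := expR_gt0 z.
  have : expR z * (1 - z) <= expR z * expR (- z).
    by rewrite ler_pM2l// expR_ge1Dx.
  rewrite -expRD subrr expR0; lra.
have h'0 : h' 0 = 0 by rewrite /h' expR0; ring.
have h0 : h 0 = 0 by rewrite /h expR0; ring.
have cf a b : {within `[a, b], continuous h}.
  apply: continuous_subspaceT => z.
  by apply: differentiable_continuous; apply/derivable1_diffP; have := dh z.
have [x0|x0|->] := ltgtP x 0; last by rewrite h0.
- have [z zx e] := MVT x0 (fun z _ => dh z) (cf _ _).
  have : h' z <= 0 by rewrite -h'0; apply: mh'; move: zx; rewrite in_itv/= => /andP[_ /ltW].
  nra.
- have [z zx e] := MVT x0 (fun z _ => dh z) (cf _ _).
  have : 0 <= h' z by rewrite -h'0; apply: mh'; move: zx; rewrite in_itv/= => /andP[/ltW].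
  nra.
Qed.

(** The Padé bound is exactly [1 + x + x ^+ 2 / (2 * (1 - x / 3))], and replacing [x] by [b] in the
    denominator only increases it. Only an upper bound on [x] enters, as in Bernstein's
    inequality. *)
Lemma expR_le_bernstein x b : x <= b -> b < 3 ->
  expR x <= 1 + x + x ^+ 2 / (2 * (1 - b / 3)).
Proof.
move=> xb b3.
have H := expR_pade x.
have b0 : 0 < 1 - b / 3 by lra.
have x0 : 0 < 1 - x / 3 by lra.
have H1 : expR x <= 1 + x + x ^+ 2 / (2 * (1 - x / 3)).
  have -> : 1 + x + x ^+ 2 / (2 * (1 - x / 3)) = (6 + 4 * x + x ^+ 2) / (6 - 2 * x).
    by field; lra.
  by rewrite ler_pdivlMr//; lra.
apply: (le_trans H1); rewrite lerD2l ler_wpM2l ?sqr_ge0//.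
by rewrite lef_pV2 ?posrE; lra.
Qed.

(* The Chernoff parameter [l = 1 / (c + t)] with [V = 2 L t^2] makes the exponent exactly [- L]. *)
Lemma subgamma_exponent c t L (l := (c + t)^-1) : 0 <= c -> 0 < t ->
  - l * (2 * L * t + c * L) + 2 * L * t ^+ 2 * (l ^+ 2 / (2 * (1 - l * c))) = - L.
Proof.
move=> c0 t0; rewrite /l.
by field; lra.
Qed.

End bernstein_real.

(** * Finitely valued random elements *)

Section finite_valued.
Context {d : measure_display} {Omega : measurableType d}.

(** Measurability is stated fiber by fiber, so that [F] needs no sigma-algebra. *)
Definition measurable_fibers (F : finType) (W : Omega -> F) :=
  forall v, measurable (W @^-1` [set v]).

Lemma preimage_fibers (F : finType) (W : Omega -> F) (D : set F) :
  W @^-1` D = \bigcup_(v in D) (W @^-1` [set v]).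
Proof. by apply/seteqP; split => [w Dw|w [v Dv] /= ->//]; exists (W w). Qed.

Lemma measurable_fibers_preimage (F : finType) (W : Omega -> F) (D : set F) :
  measurable_fibers W -> measurable (W @^-1` D).
Proof.
move=> mW; rewrite preimage_fibers.
by apply: fin_bigcup_measurable => [|v _]//; exact: finite_finset.
Qed.

Lemma measure_fibers (R : realType) (m : {measure set Omega -> \bar R})
    (F : finType) (W : Omega -> F) (D : set F) : measurable_fibers W ->
  m (W @^-1` D) = (\sum_(v | v \in D) m (W @^-1` [set v]))%E.
Proof.
move=> mW; rewrite preimage_fibers measure_fin_bigcup//; last 2 first.
- exact: finite_finset.
- by move=> x y _ _ [w [/= <- <-]].
rewrite -[RHS]big_filter [RHS]fsbig_seq ?filter_uniq ?index_enum_uniq//.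
apply: eq_fsbigl; apply/seteqP; split => v /=.
  by rewrite mem_filter mem_index_enum andbT => /mem_set.
by rewrite mem_filter => /andP[/set_mem].
Qed.

Lemma measurable_fibers_pair (F G : finType) (V : Omega -> F) (W : Omega -> G) :
  measurable_fibers V -> measurable_fibers W ->
  measurable_fibers (fun w => (V w, W w)).
Proof.
move=> mV mW [x y].
rewrite (_ : _ @^-1` _ = V @^-1` [set x] `&` W @^-1` [set y]); first exact: measurableI.
by apply/seteqP; split => w /= [-> ->].
Qed.

Lemma measurable_fibers_bool (A : set Omega) :
  measurable A -> measurable_fibers (fun w => w \in A).
Proof.
move=> mA; have mT : measurable ((fun w => w \in A) @^-1` [set true]).
  rewrite (_ : _ @^-1` _ = A) //.
  by apply/seteqP; split => w /= => [/set_mem|/mem_set].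
case=> //.
rewrite (_ : _ @^-1` _ = ~` ((fun w => w \in A) @^-1` [set true])).
  exact: measurableC.
by apply/seteqP; split => w /=; case: (w \in A).
Qed.

Lemma measurable_fibers_ffun (I F : finType) (W : I -> Omega -> F) :
  (forall i, measurable_fibers (W i)) ->
  measurable_fibers (fun w => [ffun i => W i w]).
Proof.
move=> mW b.
rewrite (_ : _ @^-1` _ = \big[setI/setT]_(i : I) (W i @^-1` [set b i])).
  by apply: bigsetI_measurable => i _; exact: mW.
rewrite -bigcap_seq; apply/seteqP; split => [w /= <- i _|w H] /=; first by rewrite ffunE.
by apply/ffunP => i; rewrite ffunE; apply: (H i); rewrite /= mem_index_enum.
Qed.

End finite_valued.

Lemma measurable_fibers_precomp d d' (T : measurableType d) (U : measurableType d')
  (F : finType) (W : U -> F) (f : T -> U) :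
  measurable_fun setT f -> measurable_fibers W -> measurable_fibers (W \o f).
Proof.
by move=> mf mW v; rewrite comp_preimage -[X in measurable X]setTI; exact: mf.
Qed.

(** * Expectations as finite sums *)

Section finite_expectation.
Context {d : measure_display} {Omega : measurableType d} {R : realType}.
Variable P : probability Omega R.

Definition pr (A : set Omega) : R := fine (P A).

Lemma prE A : measurable A -> P A = (pr A)%:E.
Proof. by move=> mA; rewrite /pr fineK// fin_num_measure. Qed.

Lemma pr_ge0 A : 0 <= pr A.
Proof. by rewrite fine_ge0. Qed.

Lemma pr_le1 A : measurable A -> pr A <= 1.
Proof. by move=> mA; rewrite -lee_fin -prE// probability_le1. Qed.

Lemma pr_setC A : measurable A -> pr (~` A) = 1 - pr A.
Proof. by move=> mA; rewrite /pr probability_setC// prE. Qed.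

Lemma le_pr A B : measurable A -> measurable B -> A `<=` B -> pr A <= pr B.
Proof.
by move=> mA mB AB; rewrite -lee_fin -!prE// le_measure// inE.
Qed.

Lemma pr_setU_le A B : measurable A -> measurable B -> pr (A `|` B) <= pr A + pr B.
Proof.
move=> mA mB; rewrite -lee_fin EFinD -!prE//; last exact: measurableU.
exact: measureU2.
Qed.

Lemma pr_fibers (F : finType) (W : Omega -> F) (D : set F) : measurable_fibers W ->
  pr (W @^-1` D) = \sum_(v | v \in D) pr (W @^-1` [set v]).
Proof.
move=> mW; apply: EFin_inj; rewrite -prE; last exact: measurable_fibers_preimage.
rewrite measure_fibers// -sumEFin; apply: eq_bigr => v _.
by apply: prE; exact: mW.
Qed.

Definition Ex (F : finType) (W : Omega -> F) (f : F -> R) : R :=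
  \sum_v f v * pr (W @^-1` [set v]).

Lemma Ex_comp (F G : finType) (W : Omega -> F) (h : F -> G) (f : G -> R) :
  measurable_fibers W -> Ex (h \o W) f = Ex W (f \o h).
Proof.
move=> mW; rewrite /Ex.
under eq_bigr => v _ do rewrite comp_preimage (pr_fibers _ mW) mulr_sumr.
rewrite (exchange_big_dep predT)//=; apply: eq_bigr => w _.
rewrite (big_pred1 (h w)) // => v /=.
by apply/idP/eqP => [/set_mem ->|->]//; apply/mem_set.
Qed.

(** Both sides become sums over the values of the pair [(V, W)]: a pair that is never attained has
    an empty fiber, hence weight 0, and on attained pairs [f] and [g] agree. *)
Lemma Ex_eq_on (F G : finType) (V : Omega -> F) (W : Omega -> G) (f : F -> R) (g : G -> R) :
  measurable_fibers V -> measurable_fibers W -> (forall w, f (V w) = g (W w)) ->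
  Ex V f = Ex W g.
Proof.
move=> mV mW fg; pose VW w := (V w, W w).
have mVW : measurable_fibers VW by exact: measurable_fibers_pair.
rewrite (_ : V = fst \o VW)// (_ : W = snd \o VW)// !Ex_comp//.
apply: eq_bigr => -[x y] _ /=.
have [[w [<- <-]]|nW] := pselect (exists w, VW w = (x, y)); first by rewrite fg.
rewrite (_ : VW @^-1` _ = set0); first by rewrite /pr measure0 !mulr0.
by apply/seteqP; split => // w VWw; case: nW; exists w.
Qed.

Lemma Ex_indic (F : finType) (W : Omega -> F) (D : set F) : measurable_fibers W ->
  Ex W (fun v => (v \in D)%:R) = pr (W @^-1` D).
Proof.
move=> mW; rewrite (pr_fibers _ mW) /Ex [RHS]big_mkcond/=.
by apply: eq_bigr => v _; case: ifP; rewrite ?mul1r ?mul0r.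
Qed.

Lemma Ex_cst (F : finType) (W : Omega -> F) (c : R) : measurable_fibers W ->
  Ex W (fun=> c) = c.
Proof.
move=> mW; have := Ex_indic setT mW; rewrite /Ex preimage_setT.
under eq_bigr do rewrite in_setT.
rewrite /pr probability_setT/= => e.
by rewrite -[RHS]mulr1 -e mulr_sumr; apply: eq_bigr => v _; rewrite mul1r.
Qed.

Lemma le_Ex (F : finType) (W : Omega -> F) (f g : F -> R) :
  (forall v, f v <= g v) -> Ex W f <= Ex W g.
Proof. by move=> fg; apply: ler_sum => v _; rewrite ler_wpM2r// pr_ge0. Qed.

Lemma eq_Ex (F : finType) (W : Omega -> F) (f g : F -> R) : f =1 g -> Ex W f = Ex W g.
Proof. by move=> fg; apply: eq_bigr => v _; rewrite fg. Qed.

Lemma ExD (F : finType) (W : Omega -> F) (f g : F -> R) :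
  Ex W (fun v => f v + g v) = Ex W f + Ex W g.
Proof. by rewrite /Ex -big_split/=; apply: eq_bigr => v _; rewrite mulrDl. Qed.

Lemma ExZ (F : finType) (W : Omega -> F) (c : R) (f : F -> R) :
  Ex W (fun v => c * f v) = c * Ex W f.
Proof. by rewrite /Ex mulr_sumr; apply: eq_bigr => v _; rewrite mulrA. Qed.

Lemma Ex_sum (F I : finType) (W : Omega -> F) (f : I -> F -> R) :
  Ex W (fun v => \sum_i f i v) = \sum_i Ex W (f i).
Proof.
rewrite /Ex exchange_big/=; apply: eq_bigr => v _.
by rewrite mulr_suml.
Qed.

End finite_expectation.

(** * Coupling past and future blocks *)

Section coupling.
Context {R : realType} {d : measure_display} {Omega : measurableType d}.
Variable P : probability Omega R.
Context {dT : measure_display} {T : measurableType dT}.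
Variable Z : int -> Omega -> T.
Hypothesis mZ : forall t, measurable_fun setT (Z t).
Hypothesis stZ : stationary P Z.

Definition tup (k : nat) (t : 'I_k -> int) (w : Omega) : k.-tuple T :=
  [tuple Z (t i) w | i < k].

Lemma measurable_tup k (t : 'I_k -> int) : measurable_fun setT (tup t).
Proof.
apply/measurable_fun_tnthP => i.
rewrite (_ : _ \o _ = Z (t i)); first exact: mZ.
by apply/funext => w /=; rewrite tnth_mktuple.
Qed.

Definition tupM k (t : 'I_k -> int) : {mfun Omega >-> k.-tuple T} :=
  mfun_Sub (mem_set (measurable_tup t)).

Lemma measurable_seqspaceP d' (U : measurableType d') (f : U -> seqspace T) :
  (forall n, measurable_fun setT (fun u => f u n)) -> measurable_fun setT f.
Proof.
move=> mf; apply: (@measurability _ _ U (seqspace T) setT f (@coord_sets _ T)) => //.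
move=> _ [_ [n _ [A mA <-]] <-].
have := mf n measurableT A mA; rewrite !setTI; apply.
Qed.

Lemma measurable_seqspace_coord n : measurable_fun setT (fun v : seqspace T => v n).
Proof.
move=> _ A mA; apply: sub_sigma_algebra; exists n => //; by exists A.
Qed.

Lemma measurable_past : measurable_fun setT (past_block Z).
Proof. by apply: measurable_seqspaceP => n; exact: mZ. Qed.

Lemma measurable_future a : measurable_fun setT (future_block Z a).
Proof. by apply: measurable_seqspaceP => n; exact: mZ. Qed.

Definition pastM : {mfun Omega >-> seqspace T} := mfun_Sub (mem_set measurable_past).
Definition futureM a : {mfun Omega >-> seqspace T} :=
  mfun_Sub (mem_set (measurable_future a)).

Lemma tup_shift k (t : 'I_k -> int) h (A : set (k.-tuple T)) : measurable A ->
  P (tup (fun i => t i + h) @^-1` A) = P (tup t @^-1` A).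
Proof.
move=> mA; have := stZ [tuple t i | i < k] h mA.
have eh w : [tuple Z (tnth [tuple t i | i < k] i + h) w | i < k] = tup (fun i => t i + h) w.
  by apply: eq_mktuple => i; rewrite tnth_mktuple.
have e0 w : [tuple Z (tnth [tuple t i | i < k] i) w | i < k] = tup t w.
  by apply: eq_mktuple => i; rewrite tnth_mktuple.
by congr (P _ = P _); apply/seteqP; split => w /=; rewrite ?eh ?e0.
Qed.

Lemma abse_prob_sub (p q : \bar R) : (0 <= p <= 1)%E -> (0 <= q <= 1)%E -> (`|p - q| <= 1)%E.
Proof.
move: p q => [p| |] [q| |] => /andP[+ +] /andP[] //.
by rewrite -EFinB abse_EFin !lee_fin ler_norml; lra.
Qed.

(** [beta_coef] is the [fine] part of a supremum, which would be a default value if the supremum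
    were infinite. Differences of probabilities are at most 1, so it is finite and still an upper
    bound. *)
Lemma beta_coefP g (A : set (seqspace T * seqspace T)) : measurable A ->
  (`| P [set w | A (past_block Z w, future_block Z g w)]
      - (distribution P pastM \x distribution P (futureM g)) A | <= (beta_coef P Z g)%:E)%E.
Proof.
move=> mA; rewrite /beta_coef.
set S := [set _ | _ in _].
have Sub : ubound S 1%E.
  move=> _ [B mB <-]; apply: abse_prob_sub; apply/andP; split.
  - exact: (measure_ge0 P).
  - apply: (@probability_le1 _ _ _ P); rewrite -[X in measurable X]setTI.
    by apply: measurable_fun_pair => //; [exact: measurable_past|exact: measurable_future].
  - exact: (measure_ge0 (distribution P pastM \x distribution P (futureM g))%E).
  - exact: (@probability_le1 _ _ _ (distribution P pastM \x distribution P (futureM g))%E).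
have SA : S (`| P [set w | A (past_block Z w, future_block Z g w)]
      - (distribution P pastM \x distribution P (futureM g)) A |%E) by exists A.
rewrite fineK; first exact: ereal_sup_ubound.
rewrite ge0_fin_numE; last by apply: (le_trans _ (ereal_sup_ubound SA)).
by apply: (@le_lt_trans _ _ 1%E); [exact: ge_ereal_sup|rewrite ltry].
Qed.

Lemma beta_coef_ge0 g : 0 <= beta_coef P Z g.
Proof.
have := @beta_coefP g set0 measurable0.
by move/(le_trans (abse_ge0 _)); rewrite lee_fin.
Qed.

Lemma integral_law k l (t : 'I_k -> int) (u : 'I_l -> int) (E : set (k.-tuple T * l.-tuple T)) :
  measurable E ->
  ((distribution P (tupM t) \x distribution P (tupM u)) E
   = \int[P]_w P [set w' | E (tup t w, tup u w')])%E.
Proof.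
move=> mE; rewrite /product_measure1 ge0_integral_distribution//.
- apply: eq_integral => w _ /=; congr (P _).
  by apply/seteqP; split => w' /=; rewrite /xsection/= ?inE.
- exact: measurable_fun_xsection.
Qed.

Lemma law_shift k (t : 'I_k -> int) h (A : set (k.-tuple T)) : measurable A ->
  distribution P (tupM (fun i => t i + h)) A = distribution P (tupM t) A.
Proof. exact: tup_shift. Qed.

(** [beta_coef] compares blocks cut at time 0. Shifting by [- h] moves the [t i] to times at most 0
    and the [u j] to times at least [g], where both tuples are read off the two infinite blocks;
    stationarity then undoes the shift in the joint law and in the product law. *)
Lemma coupling k l (t : 'I_k -> int) (u : 'I_l -> int) (h : int) (g : nat)
    (E : set (k.-tuple T * l.-tuple T)) :
  (forall i, t i <= h) -> (forall j, h + g%:Z <= u j) -> measurable E ->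
  (`| P [set w | E (tup t w, tup u w)]
      - (distribution P (tupM t) \x distribution P (tupM u)) E | <= (beta_coef P Z g)%:E)%E.
Proof.
move=> th hu mE.
(* Coordinate [n] of [past_block] is time [- n], that of [future_block] is time [g + n]. The
   absolute values are exact since [t i - h <= 0] and [u j - h - g >= 0]. *)
pose pf (v : seqspace T) : k.-tuple T := [tuple v (absz (t i - h)%R) | i < k].
pose ff (v : seqspace T) : l.-tuple T := [tuple v (absz (u j - h - g%:Z)%R) | j < l].
have mpf : measurable_fun setT pf.
  apply/measurable_fun_tnthP => i; rewrite (_ : _ \o _ = fun v : seqspace T => v (absz (t i - h)%R)).
    exact: measurable_seqspace_coord.
  by apply/funext => w /=; rewrite tnth_mktuple.
have mff : measurable_fun setT ff.
  apply/measurable_fun_tnthP => i; rewrite (_ : _ \o _ = fun v : seqspace T => v (absz (u i - h - g%:Z)%R)).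
    exact: measurable_seqspace_coord.
  by apply/funext => w /=; rewrite tnth_mktuple.
have pfE w : pf (past_block Z w) = tup (fun i => t i - h) w.
  apply: eq_mktuple => i; rewrite /past_block; congr (Z _ w).
  by have := th i; lia.
have ffE w : ff (future_block Z g w) = tup (fun i => u i - h) w.
  apply: eq_mktuple => i; rewrite /future_block; congr (Z _ w).
  by have := hu i; lia.
pose A := [set v : seqspace T * seqspace T | E (pf v.1, ff v.2)].
have mA : measurable A.
  rewrite -[A]setTI; pose G (v : seqspace T * seqspace T) := (pf v.1, ff v.2).
  have mG : measurable_fun setT G.
    by apply: measurable_fun_pair; exact: measurableT_comp.
  exact: mG.
have := beta_coefP g mA.
congr ((`|_ - _| <= _)%E).
(* Stationarity speaks of one tuple of times, so [t] and [u] are concatenated and split again by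
   [sp]. *)
- pose tu (i : 'I_(k + l)) : int := match fintype.split i with inl a => t a | inr b => u b end.
  pose sp (v : (k + l).-tuple T) : k.-tuple T * l.-tuple T :=
    ([tuple tnth v (lshift l i) | i < k], [tuple tnth v (rshift k j) | j < l]).
  have msp : measurable_fun setT sp.
    apply: measurable_fun_pair; apply/measurable_fun_tnthP => i.
      rewrite (_ : _ \o _ = (fun v => tnth v (lshift l i))); first exact: measurable_tnth.
      by apply/funext => w /=; rewrite tnth_mktuple.
    rewrite (_ : _ \o _ = (fun v => tnth v (rshift k i))); first exact: measurable_tnth.
    by apply/funext => w /=; rewrite tnth_mktuple.
  have mspE : measurable (sp @^-1` E) by rewrite -[X in measurable X]setTI; exact: msp.
  have spE w (r : int -> int) : sp (tup (r \o tu) w) = (tup (r \o t) w, tup (r \o u) w).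
    by congr (_, _); apply: eq_mktuple => i;
      rewrite tnth_mktuple /= /tu ?(unsplitK (inl i)) ?(unsplitK (inr i)).
  have := tup_shift tu (- h) mspE.
  congr (P _ = P _); apply/seteqP; split => w /=.
  - by rewrite (spE _ (+%R^~ (- h))) /A/= pfE ffE.
  - by rewrite (spE _ (+%R^~ (- h))) /A/= pfE ffE.
  - by rewrite (spE _ id).
  - by rewrite (spE _ id).
(* In the product law the marginals are shifted back one at a time: the outer one by a change of
   measure, the inner one section by section. *)
- pose t' i := t i - h; pose u' i := u i - h.
  transitivity (\int[P]_w P [set w' | E (tup t' w, tup u' w')])%E.
    rewrite /product_measure1 ge0_integral_distribution//.
      apply: eq_integral => w _ /=; congr (P _).
      by apply/seteqP; split => w' /=; rewrite /xsection/= inE /A/= pfE ffE.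
    exact: measurable_fun_xsection.
  rewrite -integral_law// /product_measure1.
  rewrite (eq_measure_integral (distribution P (tupM t))); last first.
    by move=> B mB _; exact: law_shift.
  apply: eq_integral => v _ /=; apply: law_shift.
  exact: measurable_xsection.
Qed.

End coupling.

(** * Real-valued consequences of the coupling bound *)

Section coupling_real.
Context {R : realType} {d : measure_display} {Omega : measurableType d}.
Variable P : probability Omega R.
Context {dT : measure_display} {T : measurableType dT}.
Variable Z : int -> Omega -> T.
Hypothesis mZ : forall t, measurable_fun setT (Z t).
Hypothesis stZ : stationary P Z.
Variables (k l : nat) (t : 'I_k -> int) (u : 'I_l -> int) (h : int) (g : nat).
Hypotheses (th : forall i, t i <= h) (hu : forall j, h + g%:Z <= u j).

Let measurable_tup2 (E : set (k.-tuple T * l.-tuple T)) : measurable E ->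
  measurable [set w | E (tup Z t w, tup Z u w)].
Proof.
move=> mE; rewrite -[X in measurable X]setTI.
by apply: (measurable_fun_pair (measurable_tup mZ t) (measurable_tup mZ u)).
Qed.

(** This replaces conditioning on the first tuple: a bound uniform over its frozen values [z] bounds
    the product measure by Fubini, and passing to the joint law costs one [beta]. *)
Lemma coupling_section (E : set (k.-tuple T * l.-tuple T)) (kappa : R) : measurable E ->
  (forall z, pr P [set w | E (z, tup Z u w)] <= kappa) ->
  pr P [set w | E (tup Z t w, tup Z u w)] <= kappa + beta_coef P Z g.
Proof.
move=> mE Ek.
have mEz z : measurable [set w | E (z, tup Z u w)].
  have := measurable_tup mZ u measurableT (measurable_xsection z mE).
  by rewrite setTI; congr measurable; apply/seteqP; split => w /=; rewrite /xsection/= inE.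
have := coupling mZ stZ th hu mE.
set Q := product_measure1 _ _ _ => H.
have Q0 : (0 <= Q)%E.
  exact: (measure_ge0 (distribution P (tupM mZ t) \x distribution P (tupM mZ u))%E).
have Qk : (Q <= kappa%:E)%E.
  rewrite /Q integral_law//.
  apply: (@le_trans _ _ (\int[P]_w kappa%:E)%E); last first.
    by rewrite integral_cst//= [X in (_ * X)%E](@probability_setT _ _ _ P) mule1.
  apply: ge0_le_integral => //; last by move=> w _; rewrite prE// lee_fin.
  rewrite (_ : (fun w => _) = (distribution P (tupM mZ u) \o xsection E) \o tup Z t).
    apply: (@measurable_comp _ _ _ _ _ _ setT) => //; last exact: measurable_tup.
    exact: measurable_fun_xsection.
  apply/funext => w /=; congr (P _).
  by apply/seteqP; split => w' /=; rewrite /xsection/= inE.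
move: H; rewrite prE; last exact: measurable_tup2.
have Qf : Q \is a fin_num by rewrite ge0_fin_numE// (le_lt_trans Qk)// ltry.
rewrite -(fineK Qf) -EFinB abse_EFin lee_fin.
move: Qk; rewrite -(fineK Qf) lee_fin => q1 /(le_trans (ler_norm _)); lra.
Qed.

Variables (F G : finType) (f : k.-tuple T -> F) (k' : l.-tuple T -> G).
Hypotheses (mf : measurable_fibers f) (mk' : measurable_fibers k').

Let V := f \o tup Z t.
Let W := k' \o tup Z u.
Let VW w := (V w, W w).

Let mVW : measurable_fibers VW.
Proof.
by apply: measurable_fibers_pair; apply: measurable_fibers_precomp => //; exact: measurable_tup.
Qed.

Lemma coupling_fibers (D : set (F * G)) :
  pr P (VW @^-1` D) <=
  \sum_(x | x \in D) pr P (V @^-1` [set x.1]) * pr P (W @^-1` [set x.2]) + beta_coef P Z g.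
Proof.
pose fk (z : k.-tuple T * l.-tuple T) := (f z.1, k' z.2).
have mfk : measurable_fibers fk.
  by apply: measurable_fibers_pair; exact: measurable_fibers_precomp.
have mE : measurable (fk @^-1` D) by exact: measurable_fibers_preimage.
have := coupling mZ stZ th hu mE.
rewrite (measure_fibers (distribution P (tupM mZ t) \x distribution P (tupM mZ u))%E)//.
rewrite (eq_bigr (fun x => (pr P (V @^-1` [set x.1]) * pr P (W @^-1` [set x.2]))%:E)); last first.
  move=> [x y] _.
  rewrite (_ : fk @^-1` _ = (f @^-1` [set x]) `*` (k' @^-1` [set y])).
    transitivity (distribution P (tupM mZ t) (f @^-1` [set x])
                  * distribution P (tupM mZ u) (k' @^-1` [set y]))%E.
      exact: product_measure1E.
    rewrite EFinM; congr (_ * _)%E; apply: prE;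
      by apply: measurable_fibers_precomp => //; exact: measurable_tup.
  by apply/seteqP; split => -[a b] /= [fa kb]; rewrite /fk/= ?fa ?kb.
rewrite sumEFin prE; last exact: measurable_tup2.
rewrite -EFinB abse_EFin lee_fin => /(le_trans (ler_norm _)).
by rewrite lerBlDl addrC.
Qed.

(* The supremum over [0,1]-valued [phi] is attained at the indicator of
   the set where the joint mass exceeds the product mass. *)
Lemma decoupling (phi : F -> G -> R) : (forall x y, 0 <= phi x y <= 1) ->
  Ex P VW (fun x => phi x.1 x.2) <=
  \sum_x \sum_y phi x y * pr P (W @^-1` [set y]) * pr P (V @^-1` [set x]) + beta_coef P Z g.
Proof.
move=> phi01.
pose q (x : F * G) := pr P (V @^-1` [set x.1]) * pr P (W @^-1` [set x.2]).
pose D := [set x : F * G | q x <= pr P (VW @^-1` [set x])].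
have H := coupling_fibers D.
rewrite (pr_fibers _ _ mVW) -lerBlDl -sumrB in H.
rewrite pair_bigA/= -lerBlDl -sumrB.
apply: le_trans H; rewrite [leRHS]big_mkcond/=; apply: ler_sum => -[x y] _ /=.
have /andP[p0 p1] := phi01 x y.
rewrite -mulrA (mulrC (pr P (W @^-1` _))) -mulrBr.
case: ifPn => [/set_mem|/negP xD].
  by rewrite /D /q/= => ?; rewrite ler_piMl// subr_ge0.
have : ~ (D (x, y)) by move=> /mem_set.
by rewrite /D /q/= => /negP; rewrite -ltNge => ?; rewrite mulr_ge0_le0// subr_le0 ltW.
Qed.

End coupling_real.

(** * Bernstein's inequality for blocks *)

(** With truncated subtraction [(i - j) + (j - i)] is the distance between [i] and [j]. Going from
    [a] to [a + 1] adds one diagonal term, a row and a column; the row and the column each sum [b]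
    over the distances 1 to [a]. *)
Lemma double_sum_dist (R : comRingType) (g0 : R) (b : nat -> R) (a : nat) :
  \sum_(i < a) \sum_(j < a) (if i == j then g0 else b ((i - j) + (j - i))%N) =
  a%:R * g0 + 2 * \sum_(1 <= j < a) (a - j)%:R * b j.
Proof.
pose F (i j : nat) := if i == j then g0 else b ((i - j) + (j - i))%N.
have -> : \sum_(i < a) \sum_(j < a) (if i == j then g0 else b ((i - j) + (j - i))%N) =
  \sum_(0 <= i < a) \sum_(0 <= j < a) F i j.
  rewrite big_mkord; apply: eq_bigr => i _; rewrite big_mkord; apply: eq_bigr => j _.
  by rewrite /F.
elim: a => [|a IHa]; first by rewrite !big_geq// mul0r mulr0 addr0.
have sumF : \sum_(0 <= i < a) F i a = \sum_(1 <= j < a.+1) b j.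
  rewrite big_nat_rev/= add0n big_add1/=; apply: eq_big_nat => i /andP[_ ia].
  by rewrite /F; case: ifPn => [|_]; [lia|congr b; lia].
have sumF' : \sum_(0 <= i < a) F a i = \sum_(1 <= j < a.+1) b j.
  rewrite -sumF; apply: eq_big_nat => i /andP[_ ia].
  rewrite /F eq_sym addnC //.
have sumFa : \sum_(0 <= j < a.+1) F a j = \sum_(1 <= j < a.+1) b j + F a a.
  by rewrite big_nat_recr//= sumF'.
rewrite big_nat_recr//= sumFa (eq_bigr (fun i => \sum_(0 <= j < a) F i j + F i a)); last first.
  by move=> i _; rewrite big_nat_recr.
rewrite big_split/= IHa sumF.
have -> : \sum_(1 <= j < a.+1) (a.+1 - j)%:R * b j =
  \sum_(1 <= j < a) (a - j)%:R * b j + \sum_(1 <= j < a.+1) b j.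
  rewrite [in LHS](eq_big_nat _ _ (F2 := fun j => (a - j)%:R * b j + b j)); last first.
    move=> j /andP[_ ja]; rewrite subSn// -natr1; ring.
  rewrite big_split/=; congr (_ + _).
  case: a {IHa sumF sumF' sumFa} => [|a]; first by rewrite !big_geq.
  by rewrite big_nat_recr//= subnn mul0r addr0.
have -> : F a a = g0 by rewrite /F eqxx.
rewrite -[a.+1%:R]natr1; ring.
Qed.

Section block_bernstein.
Context {R : realType} {d : measure_display} {Omega : measurableType d}.
Variable P : probability Omega R.
Context {dT : measure_display} {T : measurableType dT}.
Variable Z : int -> Omega -> T.
Hypothesis mZ : forall t, measurable_fun setT (Z t).
Hypothesis stZ : stationary P Z.
Variable C : set T.
Hypothesis mC : measurable C.

Local Notation beta := (beta_coef P Z).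

Definition hits n (t : nat -> int) (w : Omega) : nat := \sum_(i < n) (Z (t i) w \in C).

Let memt n (v : n.-tuple T) : {ffun 'I_n -> bool} := [ffun i => tnth v i \in C].
Let total n (b : {ffun 'I_n -> bool}) : nat := \sum_(i < n) b i.
Let idx n (t : nat -> int) : 'I_n -> int := fun i => t i.
Let bits n t w := memt (tup Z (idx (n:=n) t) w).

Let hitsE n t : hits n t = @total n \o @bits n t.
Proof.
by apply/funext => w; apply: eq_bigr => i _; rewrite ffunE tnth_mktuple.
Qed.

Let measurable_memt n : measurable_fibers (@memt n).
Proof.
apply: measurable_fibers_ffun => i.
apply: (measurable_fibers_precomp (measurable_tnth i)).
exact: measurable_fibers_bool.
Qed.

Let measurable_bits n t : measurable_fibers (@bits n t).
Proof. by apply: measurable_fibers_precomp => //; exact: measurable_tup. Qed.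

Let p := pr P (Z 0 @^-1` C).

Let pr_hit t : pr P (Z t @^-1` C) = p.
Proof.
have mA : measurable ((fun v : 1.-tuple T => tnth v ord0) @^-1` C).
  by rewrite -[X in measurable X]setTI; exact: measurable_tnth.
have := tup_shift stZ (fun=> 0) t mA.
rewrite /p /pr => e; congr fine; move: e; congr (P _ = P _); apply/seteqP; split => w /=;
  by rewrite tnth_mktuple ?add0r.
Qed.

Let p01 : 0 <= p <= 1.
Proof.
by rewrite pr_ge0 pr_le1// -[X in measurable X]setTI; exact: mZ.
Qed.

Let bits_shift n (t : nat -> int) h b :
  pr P (@bits n (fun i => t i + h) @^-1` [set b]) = pr P (@bits n t @^-1` [set b]).
Proof.
congr fine; have := tup_shift stZ (idx (n:=n) t) h (measurable_memt b).
by congr (P _ = P _).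
Qed.

(** Coupling of two one-element tuples: the covariance of two indicators at distance [k] is at most
    [beta k]. *)
Lemma pr_hit2 (i j : int) (k : nat) : j = i + k%:Z ->
  pr P (Z i @^-1` C `&` Z j @^-1` C) <= p ^+ 2 + beta k.
Proof.
move=> ->.
pose f (v : 1.-tuple T) := tnth v ord0 \in C.
have mf : measurable_fibers f.
  apply: (measurable_fibers_precomp (measurable_tnth ord0)).
  exact: measurable_fibers_bool.
have := coupling_fibers mZ stZ (t := fun _ : 'I_1 => i) (u := fun _ : 'I_1 => i + k%:Z)
  (h := i) (g := k) (fun=> lexx _) (fun=> lexx _) mf mf [set (true, true)].
have pC t : pr P ((f \o tup Z (fun=> t)) @^-1` [set true]) = p.
  rewrite -(pr_hit t); congr (pr P _).
  by apply/seteqP; split => w /=; rewrite /f tnth_mktuple; [move/set_mem|move/mem_set].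
rewrite (big_pred1 (true, true)); last first.
  by move=> x /=; apply/idP/eqP => [/set_mem|->]//; exact/mem_set.
rewrite /= !pC expr2; apply: le_trans.
rewrite le_eqVlt; apply/orP; left; apply/eqP; congr (pr P _).
apply/seteqP; split => w /=; rewrite /f !tnth_mktuple.
  by move=> [/mem_set -> /mem_set ->].
by move=> [/set_mem ? /set_mem].
Qed.

Let dev a (b : {ffun 'I_a -> bool}) : R := (total b)%:R - a%:R * p.

Let devE a (b : {ffun 'I_a -> bool}) : dev b = \sum_i ((b i)%:R - p).
Proof.
by rewrite /dev /total natr_sum sumrB big_const_ord iter_addr addr0 mulr_natl.
Qed.

Let Ex_bit a t (i : 'I_a) : Ex P (@bits a t) (fun b => (b i)%:R) = p.
Proof.
rewrite -(pr_hit (t i)).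
pose D := [set b : {ffun 'I_a -> bool} | b i].
transitivity (Ex P (@bits a t) (fun b => (b \in D)%:R)).
  by apply: eq_Ex => b; congr ((nat_of_bool _)%:R); apply/idP/idP => [/mem_set|/set_mem].
rewrite Ex_indic//; congr (pr P _).
by apply/seteqP; split => w; rewrite /D /= ffunE tnth_mktuple; [move/set_mem|move/mem_set].
Qed.

Let Ex_bit2 a t (i j : 'I_a) :
  Ex P (@bits a t) (fun b => (b i)%:R * (b j)%:R) = pr P (Z (t i) @^-1` C `&` Z (t j) @^-1` C).
Proof.
pose D := [set b : {ffun 'I_a -> bool} | b i && b j].
transitivity (Ex P (@bits a t) (fun b => (b \in D)%:R)).
  apply: eq_Ex => b; rewrite -natrM mulnb; congr ((nat_of_bool _)%:R).
  by apply/idP/idP => [/mem_set|/set_mem].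
rewrite Ex_indic//; congr (pr P _); apply/seteqP; split => w; rewrite /D/= !ffunE !tnth_mktuple.
  by move=> /andP[/set_mem ? /set_mem].
by move=> [/mem_set ? /mem_set ?]; apply/andP.
Qed.

Lemma Ex_dev a t : Ex P (@bits a t) (@dev a) = 0.
Proof.
rewrite (eq_Ex _ _ (@devE a)) Ex_sum big1// => i _.
by rewrite ExD Ex_bit Ex_cst// subrr.
Qed.

(** Expanding the square, the diagonal terms are [p - p ^+ 2 <= 1 / 4] and the others are
    covariances, at most [beta] of the distance. This is the origin of the two summands in
    [sigma_tilde]. *)
Lemma Ex_dev2 a : (0 < a)%N ->
  Ex P (@bits a Posz) (fun b => dev b ^+ 2) <= a%:R * sigma_tilde beta a ^+ 2.
Proof.
move=> a0.
have b0 j : 0 <= beta j by exact: beta_coef_ge0.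
rewrite /sigma_tilde sqr_sqrtr; last first.
  rewrite addr_ge0 ?divr_ge0// mulr_ge0 ?divr_ge0// sumr_ge0// => j _.
  by rewrite mulr_ge0.
have -> : a%:R * (1 / 4 + 2 / a%:R * \sum_(1 <= j < a) (a - j)%:R * beta j) =
   a%:R * 4^-1 + 2 * \sum_(1 <= j < a) (a - j)%:R * beta j.
  by field; rewrite pnatr_eq0 -lt0n.
rewrite -double_sum_dist.
rewrite (eq_Ex _ _ (g := fun b : {ffun 'I_a -> bool} =>
  \sum_i \sum_j ((b i)%:R - p) * ((b j)%:R - p))); last first.
  move=> b; rewrite devE expr2 mulr_suml; apply: eq_bigr => i _.
  by rewrite mulr_sumr.
rewrite Ex_sum; apply: ler_sum => i _; rewrite Ex_sum; apply: ler_sum => j _.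
rewrite (eq_Ex _ _ (g := fun b : {ffun 'I_a -> bool} => (b i)%:R * (b j)%:R +
   ((- p) * (b i)%:R + ((- p) * (b j)%:R + p ^+ 2)))); last by move=> b; ring.
rewrite ExD Ex_bit2 ExD ExZ Ex_bit ExD ExZ Ex_bit Ex_cst//.
case: ifPn => [/eqP <-|ij].
  rewrite setIid pr_hit.
  have : 0 <= (p - 2^-1) ^+ 2 by exact: sqr_ge0.
  rewrite !expr2; lra.
have [ltij|ltji|eij] := ltngtP i j; last by move: ij; rewrite (val_inj eij) eqxx.
  have := @pr_hit2 (Posz i) (Posz j) ((i - j) + (j - i))%N; rewrite expr2.
  move=> /(_ ltac:(lia)); lra.
rewrite setIC; have := @pr_hit2 (Posz j) (Posz i) ((i - j) + (j - i))%N; rewrite expr2.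
move=> /(_ ltac:(lia)); lra.
Qed.

(** A block deviates upwards by at most [a], so [expR_le_bernstein] applies with [b = lam * a]. The
    linear term has mean 0, the quadratic one is bounded by the variance, and [1 + x <= expR x]
    concludes. *)
Lemma Ex_expR_dev a (lam : R) : (0 < a)%N -> 0 <= lam -> lam * a%:R < 3 ->
  Ex P (@bits a Posz) (fun b => expR (lam * dev b)) <=
  expR (a%:R * sigma_tilde beta a ^+ 2 * (lam ^+ 2 / (2 * (1 - lam * (a%:R / 3))))).
Proof.
move=> a0 l0 la.
set c := lam ^+ 2 / _.
have D0 : 0 < 1 - lam * (a%:R / 3) by lra.
have c0 : 0 <= c by rewrite /c divr_ge0 ?sqr_ge0//; lra.
have dev_le (b : {ffun 'I_a -> bool}) : lam * dev b <= lam * a%:R.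
  rewrite ler_wpM2l// devE.
  apply: (@le_trans _ _ (\sum_(i < a) (1 : R))); last by rewrite sumr_const card_ord.
  by apply: ler_sum => i _; have /andP[? ?] := p01; case: (b i) => /=; lra.
apply: (@le_trans _ _ (Ex P (@bits a Posz) (fun b => (1 + lam * dev b) + c * dev b ^+ 2))).
  apply: le_Ex => b; apply: (le_trans (expR_le_bernstein (dev_le b) la)).
  rewrite le_eqVlt; apply/orP; left; apply/eqP; rewrite /c; field.
  lra.
rewrite ExD ExD Ex_cst// ExZ Ex_dev mulr0 addr0 ExZ.
apply: le_trans (expR_ge1Dx _); rewrite lerD2l mulrC ler_wpM2r//.
exact: Ex_dev2.
Qed.

Variable a : nat.
Hypothesis a0 : (0 < a)%N.

(* Every other block of length [a] starting from [c]. *)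
Definition block_index (c : int) (i : nat) : int := c + (2 * a * (i %/ a) + i %% a)%N%:Z.

Let block_index_add c m i : (i < a)%N -> block_index c (m * a + i) = c + (2 * a * m + i)%N%:Z.
Proof. by move=> ia; rewrite /block_index divnMDl// divn_small// addn0 modnMDl modn_small. Qed.

Lemma hits_add n k t w : hits (n + k) t w = (hits n t w + hits k (fun i => t (n + i)%N) w)%N.
Proof. by rewrite /hits big_split_ord. Qed.

Lemma hits_blocks (c : int) m w :
  hits (2 * m * a) (fun i => c + i%:Z) w =
  (hits (m * a) (block_index c) w + hits (m * a) (block_index (c + a%:Z)) w)%N.
Proof.
elim: m => [|m IHm]; first by rewrite muln0 mul0n /hits !big_ord0.
rewrite (_ : 2 * m.+1 * a = 2 * m * a + (a + a))%N; last by lia.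
rewrite !mulSn !(addnC a (m * a)%N) !hits_add IHm addnACA; congr ((_ + _) + (_ + _))%N.
  apply: eq_bigr => i _; rewrite block_index_add//; congr (nat_of_bool (Z _ w \in C)); lia.
apply: eq_bigr => i _; rewrite block_index_add//; congr (nat_of_bool (Z _ w \in C)); lia.
Qed.

(* [iter m Top phi 0] is the expectation of [phi] at the sum of [m]
   independent copies of the number of hits in a block. *)
Let Top (phi : nat -> R) (x : nat) : R := Ex P (@bits a Posz) (fun b => phi (x + total b)%N).

Let Top01 phi : (forall x, 0 <= phi x <= 1) -> forall x, 0 <= Top phi x <= 1.
Proof.
move=> phi01 x; apply/andP; split.
  by apply: sumr_ge0 => b _; rewrite mulr_ge0 ?pr_ge0//; case/andP: (phi01 (x + total b)%N).
rewrite -(Ex_cst P 1 (@measurable_bits a Posz)); apply: le_Ex => b.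
by case/andP: (phi01 (x + total b)%N).
Qed.

Let le_Top phi psi : (forall x, phi x <= psi x) -> forall x, Top phi x <= Top psi x.
Proof. by move=> H x; apply: le_Ex => b. Qed.

(* The last block is [a] steps away from the previous ones, which trades its
   law for an independent copy at the cost of a single [beta a]. *)
Let Top_step (c : int) m (phi : nat -> R) : (forall x, 0 <= phi x <= 1) ->
  Ex P (@bits (m.+2 * a) (block_index c)) (phi \o @total _) <=
  Ex P (@bits (m.+1 * a) (block_index c)) (Top phi \o @total _) + beta a.
Proof.
move=> phi01.
pose t := idx (n := m.+1 * a) (block_index c).
pose u (j : 'I_a) : int := Posz j + (c + (2 * a * m.+1)%N%:Z).
(* The cut is the last index of the block before the final one; the final block starts [a + 1] steps
   later, so a gap of [a] is available. *)
have th i : t i <= c + (2 * a * m + a.-1)%N%:Z.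
  rewrite /t /idx /block_index; have := ltn_ord i; rewrite -ltn_divLR// => ?.
  have := ltn_pmod i a0; nia.
have hu j : c + (2 * a * m + a.-1)%N%:Z + a%:Z <= u j by rewrite /u; lia.
have := decoupling mZ stZ th hu (@measurable_memt (m.+1 * a)) (@measurable_memt a)
  (phi := fun x y => phi (total x + total y)%N) (fun _ _ => phi01 _).
congr (_ <= _ + _); last first.
  apply: eq_bigr => x _; rewrite /= /Top mulr_suml; apply: eq_bigr => y _.
  by congr (_ * _ * _); exact: (bits_shift Posz (c + (2 * a * m.+1)%N%:Z) y).
symmetry; apply: Ex_eq_on => //.
  apply: measurable_fibers_pair; apply: measurable_fibers_precomp => //; exact: measurable_tup.
move=> w /=; congr phi.
have e := congr1 (fun f => f w) (hitsE (m.+2 * a) (block_index c)).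
rewrite /= in e; rewrite -e.
have e' := congr1 (fun f => f w) (hitsE (m.+1 * a) (block_index c)).
rewrite /= in e'; rewrite -[total (memt (tup Z t w))]e'.
rewrite (mulSn m.+1) addnC hits_add; congr addn.
apply: eq_bigr => j _; rewrite ffunE tnth_mktuple block_index_add// /u.
by congr (nat_of_bool (Z _ w \in C)); lia.
Qed.

(** [Top] preserves functions with values in [0,1], so the peeling of the last block can be
    iterated. Among [m + 1] blocks only [m] are replaced: the remaining one is moved to the origin
    by stationarity, at no cost. *)
Let Top_iter (c : int) m (phi : nat -> R) : (forall x, 0 <= phi x <= 1) ->
  Ex P (@bits (m.+1 * a) (block_index c)) (phi \o @total _) <=
  iter m.+1 Top phi 0%N + m%:R * beta a.
Proof.
elim: m phi => [|m IHm] phi phi01.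
  rewrite mul0r addr0 /= /Top le_eqVlt; apply/orP; left; apply/eqP.
  rewrite /Ex mul1n; apply: eq_bigr => b _; rewrite add0n; congr (_ * _).
  rewrite -(bits_shift Posz c); congr (pr P _).
  have e w : bits a (block_index c) w = bits a (fun i => Posz i + c) w.
    apply/ffunP => i; rewrite !ffunE !tnth_mktuple /idx /block_index.
    by rewrite divn_small// modn_small// muln0 add0n addrC.
  by apply/seteqP; split => w /=; rewrite e.
apply: (le_trans (Top_step c m phi01)).
have := IHm _ (Top01 phi01); rewrite -iterSr -[m.+1%:R]natr1; lra.
Qed.

Let iter_Top_le phi psi m : (forall x, phi x <= psi x) ->
  forall x, iter m Top phi x <= iter m Top psi x.
Proof. by move=> H; elim: m => //= m; exact: le_Top. Qed.

(** Exponentials are eigenfunctions of [Top]; the eigenvalue is the moment generating function of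
    one block. *)
Let iter_Top_expR (lam u : R) m x :
  iter m Top (fun n => expR (lam * (n%:R - u))) x =
  expR (lam * (x%:R - u)) * Ex P (@bits a Posz) (fun b => expR (lam * (total b)%:R)) ^+ m.
Proof.
elim: m x => [|m IHm] x; first by rewrite mulr1.
rewrite iterS {1}/Top; under eq_Ex do rewrite IHm.
rewrite exprS mulrA -ExZ mulrC -ExZ; apply: eq_Ex => b.
rewrite mulrC; congr (_ * _); rewrite -expRD natrD; congr expR; ring.
Qed.

Local Notation sigma := (sigma_tilde beta a).

Let sigma_gt0 : 0 < sigma.
Proof.
rewrite /sigma_tilde sqrtr_gt0 ltr_pwDl// mulr_ge0// sumr_ge0// => j _.
by rewrite mulr_ge0// beta_coef_ge0.
Qed.

Let measurable_hits_ge n t (x : R) : measurable [set w | x <= (hits n t w)%:R].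
Proof.
rewrite (_ : [set w | _] = @bits n t @^-1` [set b : {ffun 'I_n -> bool} | x <= (total b)%:R]).
  exact: measurable_fibers_preimage.
by apply/seteqP; split => w /=; rewrite hitsE.
Qed.

(** The indicator [phi] of the deviation is decoupled first, since [Top_iter] wants values in [0,1].
    Monotonicity of [Top] then allows [phi] to be replaced by an exponential, whose iterates are
    explicit. *)
Let block_tail (c : int) m (L e : R) : (0 < m)%N -> 0 < L ->
  e = sigma * Num.sqrt (4 / (2 * m * a)%:R * L) + 1 / (3 * m%:R) * L ->
  pr P [set w | (m * a)%:R * (p + e) <= (hits (m * a) (block_index c) w)%:R]
  <= expR (- L) + (m - 1)%:R * beta a.
Proof.
case: m => // m _ L0 ee; rewrite subn1/=.
set u := _ * (p + e).
pose phi (x : nat) : R := (u <= x%:R)%R%:R.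
have -> : pr P [set w | u <= (hits (m.+1 * a) (block_index c) w)%:R] =
  Ex P (@bits (m.+1 * a) (block_index c)) (phi \o @total _).
  pose D := [set b : {ffun 'I_(m.+1 * a) -> bool} | u <= (total b)%:R].
  rewrite (eq_Ex _ _ (g := fun b => (b \in D)%:R)); last first.
    by move=> b; congr ((nat_of_bool _)%:R); apply/idP/idP => [/mem_set|/set_mem].
  by rewrite Ex_indic//; congr pr; apply/seteqP; split => w; rewrite /= hitsE.
have phi01 x : 0 <= phi x <= 1 by rewrite /phi ler0n lern1; case: (_ <= _).
apply: (le_trans (Top_iter c m phi01)); rewrite lerD2r.
have m0 : 0 < m.+1%:R :> R by [].
have aR0 : 0 < a%:R :> R by rewrite ltr0n.
pose y := Num.sqrt (4 / (2 * m.+1 * a)%:R * L).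
have y2 : y ^+ 2 = 2 * L / (m.+1%:R * a%:R).
  rewrite sqr_sqrtr; last by rewrite mulr_ge0 ?divr_ge0// ltW.
  by rewrite !natrM; field; rewrite !gt_eqF.
have y0 : 0 < y by rewrite sqrtr_gt0 mulr_gt0// divr_gt0// ltr0n !muln_gt0 a0.
(* For this [t], [2 * L * t ^+ 2] is the variance bound [m.+1 * a * sigma ^+ 2] of all the blocks,
   and [2 * L * t + a / 3 * L] is [m.+1 * a * e]. Hence [subgamma_exponent] with [c = a / 3] yields
   exactly [- L]. *)
pose t := sigma / y.
have t0 : 0 < t by rewrite divr_gt0.
pose lam := (a%:R / 3 + t)^-1.
have l0 : 0 < lam by rewrite invr_gt0; lra.
have la : lam * a%:R < 3 by rewrite mulrC ltr_pdivrMr; lra.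
have phile x : phi x <= expR (lam * (x%:R - u)).
  rewrite /phi; case: (leP u x%:R) => ux /=; last by rewrite expR_ge0.
  by apply: le_trans (expR_ge1Dx _); rewrite lerDl mulr_ge0 ?subr_ge0// ltW.
apply: (le_trans (iter_Top_le _ phile 0%N)).
rewrite iter_Top_expR.
have := Ex_expR_dev a0 (ltW l0) la.
set q := lam ^+ 2 / _ => HM.
have ML : Ex P (@bits a Posz) (fun b => expR (lam * (total b)%:R)) <=
    expR (lam * (a%:R * p) + a%:R * sigma ^+ 2 * q).
  rewrite expRD; apply: le_trans (ler_wpM2l (expR_ge0 (lam * (a%:R * p))) HM).
  rewrite -ExZ; apply: le_Ex => b; rewrite -expRD le_eqVlt; apply/orP; left; apply/eqP.
  by congr expR; rewrite /dev; ring.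
apply: (@le_trans _ _ (expR (lam * (0 - u)) *
  expR (lam * (a%:R * p) + a%:R * sigma ^+ 2 * q) ^+ m.+1)).
  rewrite ler_wpM2l ?expR_ge0// lerXn2r// nnegrE ?expR_ge0//.
  by apply: sumr_ge0 => b _; rewrite mulr_ge0 ?expR_ge0 ?pr_ge0.
rewrite -expRM_natl -expRD ler_expR.
have a30 : 0 <= a%:R / 3 :> R by lra.
have := subgamma_exponent L a30 t0; rewrite -/lam -/q => <-.
rewrite le_eqVlt; apply/orP; left; apply/eqP.
rewrite /u ee -/y natrM.
have -> : 2 * L * t ^+ 2 = m.+1%:R * a%:R * sigma ^+ 2.
  by rewrite /t expr_div_n y2; field; rewrite !gt_eqF.
have -> : 2 * L * t = m.+1%:R * a%:R * (sigma * y).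
  have -> : 2 * L = m.+1%:R * a%:R * y ^+ 2 by rewrite y2; field; rewrite !gt_eqF.
  by rewrite /t; field; rewrite gt_eqF.
rewrite -mulr_natl; field.
by rewrite gt_eqF.
Qed.

(** If both parities stay below their thresholds, so does their sum; the union bound doubles both
    error terms of [block_tail]. *)
Lemma hits_tail (c : int) m (L e : R) : (0 < m)%N -> 0 < L ->
  e = sigma * Num.sqrt (4 / (2 * m * a)%:R * L) + 1 / (3 * m%:R) * L ->
  pr P [set w | (2 * m * a)%:R * (pr P (Z 1 @^-1` C) + e)
               <= (hits (2 * m * a) (fun i => c + i%:Z) w)%:R]
  <= 2 * expR (- L) + 2 * (m - 1)%:R * beta a.
Proof.
move=> m0 L0 ee; rewrite pr_hit.
have H1 := block_tail c m0 L0 ee.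
have H2 := block_tail (c + a%:Z) m0 L0 ee.
set A1 := [set w | _] in H1; set A2 := [set w | _] in H2.
have mA1 : measurable A1 by exact: measurable_hits_ge.
have mA2 : measurable A2 by exact: measurable_hits_ge.
apply: (@le_trans _ _ (pr P (A1 `|` A2))); last first.
  by apply: (le_trans (pr_setU_le P mA1 mA2)); lra.
apply: le_pr; [exact: measurable_hits_ge|exact: measurableU|].
move=> w /=; rewrite hits_blocks natrD /A1 /A2 /=.
set x1 := (hits _ (block_index c) w)%:R; set x2 := (hits _ _ w)%:R.
have [|h1 h2] := leP ((m * a)%:R * (p + e)) x1; first by left.
right; move: h2; rewrite -mulnA natrM; lra.
Qed.

End block_bernstein.

(** * Quantiles and conditioning on the training data *)

Lemma measurable_set_bool d (U : measurableType d) (b : U -> bool) :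
  measurable_fun setT b -> measurable [set x | b x].
Proof.
move=> mb; rewrite (_ : [set x | _] = setT `&` b @^-1` [set true]); first exact: mb.
by rewrite setTI; apply/seteqP; split.
Qed.

Lemma measurable_set_ler d (U : measurableType d) (R : realType) (f g : U -> R) :
  measurable_fun setT f -> measurable_fun setT g -> measurable [set x | f x <= g x].
Proof. by move=> mf mg; apply: measurable_set_bool; exact: measurable_fun_ler. Qed.

Lemma measurable_set_ltr d (U : measurableType d) (R : realType) (f g : U -> R) :
  measurable_fun setT f -> measurable_fun setT g -> measurable [set x | f x < g x].
Proof. by move=> mf mg; apply: measurable_set_bool; exact: measurable_fun_ltr. Qed.

Lemma measurable_fun_mem d d' (U : measurableType d) (V : measurableType d') (R : realType)
  (B : set V) (f : U -> V) : measurable B -> measurable_fun setT f ->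
  measurable_fun setT (fun x => (f x \in B)%:R : R).
Proof.
move=> mB mf; have := measurableT_comp (measurable_indic (R := R) (D := setT) mB) mf.
by apply: eq_measurable_fun => x _; rewrite /= indicE.
Qed.

Section quantile.
Context {R : realType} {d : measure_display} {Omega : measurableType d}.
Variables (P : probability Omega R) (X : Omega -> R) (phi : R).
Hypotheses (mX : measurable_fun setT X) (phi01 : 0 < phi < 1).

Let XM : {RV P >-> R} := mfun_Sub (mem_set mX).

(** The lower quantile. For [0 < phi < 1] the set is nonempty and bounded below, so [inf] is a
    genuine infimum. *)
Definition quantile : R := inf [set t | phi <= pr P [set w | X w <= t]].

Let G t := pr P [set w | X w <= t].

Let mXle t : measurable [set w | X w <= t].
Proof. exact: measurable_set_ler. Qed.

Let mXlt t : measurable [set w | X w < t].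
Proof. exact: measurable_set_ltr. Qed.

Let cdfE t : cdf XM t = (G t)%:E.
Proof.
by rewrite -prE// /cdf /distribution /pushforward; congr (P _).
Qed.

Let Gmono t t' : t <= t' -> G t <= G t'.
Proof. by move=> tt'; apply: le_pr => // w /= /le_trans; apply. Qed.

Let hasG : has_inf [set t | phi <= G t].
Proof.
have /andP[p0 p1] := phi01.
split.
  have /fine_cvgP[_ /(cvgr_gt (1 : R)) /(_ _ p1) h] := cvg_cdfy1 XM.
  by have [t] := filter_ex h; rewrite /= cdfE => /ltW; exists t.
have /fine_cvgP[_ /(cvgr_lt (0 : R)) /(_ _ p0) h] := cvg_cdfNy0 XM.
have [t] := filter_ex h; rewrite /= cdfE /= => Gt.
exists t => t' /= Gt'; rewrite leNgt; apply/negP => /ltW /Gmono.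
by rewrite leNgt => /negP; apply; apply: lt_le_trans Gt'.
Qed.

(** The Galois connection between quantile and distribution function. Left to right is
    right-continuity: a value below [phi] at the quantile would persist slightly to its right, where
    the infimum already leaves a point of the set behind. *)
Lemma quantileP t : (quantile <= t) = (phi <= pr P [set w | X w <= t]).
Proof.
apply/idP/idP => [qt|]; last by move=> h; apply: ge_inf => //; case: hasG.
apply: (le_trans _ (Gmono qt)); rewrite leNgt; apply/negP => Gq.
have := @cdf_right_continuous _ _ _ P XM quantile.
rewrite cdfE => /fine_cvgP[_ /cvgr_lt /(_ _ Gq) h].
have h2 : \forall x \near quantile^'+, (fine \o cdf XM) x < phi /\ quantile < x.
  by apply: filterI => //; exact: nbhs_right_gt.
have [x [+ +]] := @filter_ex _ (at_right quantile) _ _ h2.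
rewrite /= cdfE /= => Gx /(inf_lt (proj1 hasG)) [y /= Gy /ltW /Gmono yx].
by move: (le_lt_trans (le_trans Gy yx) Gx); rewrite ltxx.
Qed.

(** Continuity from below along [quantile - n.+1%:R^-1], points at which the distribution function
    is still below [phi]. *)
Lemma pr_lt_quantile : pr P [set w | X w < quantile] <= phi.
Proof.
pose F n := [set w | X w <= quantile - n.+1%:R^-1].
have mF n : measurable (F n) by exact: mXle.
have UF : \bigcup_n F n = [set w | X w < quantile].
  apply/seteqP; split => [w [n _] /= h|w /= h].
    by apply: (le_lt_trans h); rewrite ltrBlDr ltrDl invr_gt0.
  have [n hn] := ltr_add_invr h.
  by exists n => //; rewrite /F/= lerBrDr ltW.
have H : ((P \o F) x @[x --> \oo] --> P (\bigcup_n F n))%classic.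
  apply: nondecreasing_cvg_mu => //; first exact: bigcup_measurable.
  move=> n m nm; apply/subsetPset => w /= /le_trans; apply.
  by rewrite lerD2l lerN2 lef_pV2 ?posrE// ler_nat.
rewrite -lee_fin -prE// -UF; apply: cvge_le H.
apply: nearW => n /=; rewrite prE// lee_fin ltW// ltNge -quantileP -ltNge.
by rewrite ltrBlDr ltrDl invr_gt0.
Qed.

End quantile.

(** * Tail bounds for sets that depend on the training data *)

Section train_tail.
Context {R : realType} {d : measure_display} {Omega : measurableType d}.
Variable P : probability Omega R.
Context {dT : measure_display} {T : measurableType dT}.
Variable Z : int -> Omega -> T.
Hypothesis mZ : forall t, measurable_fun setT (Z t).
Hypothesis stZ : stationary P Z.
Variables (ntr : nat) (B : set (ntr.-tuple T * T)).
Hypothesis mB : measurable B.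

Local Notation beta := (beta_coef P Z).

Definition training (w : Omega) : ntr.-tuple T := [tuple Z (Posz i.+1) w | i < ntr].

(** The mass of [B] for a fresh observation independent of the training data, once these are frozen
    at [z]. *)
Definition section_pr (z : ntr.-tuple T) : R := pr P [set w | B (z, Z 1 w)].

Lemma measurable_training : measurable_fun setT training.
Proof. exact: (measurable_tup mZ (fun i : 'I_ntr => Posz i.+1)). Qed.

Lemma measurable_section_pr : measurable_fun setT section_pr.
Proof.
pose Z1 : {mfun Omega >-> T} := mfun_Sub (mem_set (mZ 1)).
apply/measurable_EFinP.
rewrite (_ : _ \o _ = distribution P Z1 \o xsection B); first exact: measurable_fun_xsection.
apply/funext => z /=; rewrite /section_pr -prE.
  by congr (P _); apply/seteqP; split => w' /=; rewrite /xsection/= inE.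
have := mZ 1 measurableT (measurable_xsection z mB).
by rewrite setTI; congr measurable; apply/seteqP; split => w /=; rewrite /xsection/= inE.
Qed.

Definition freq n (t : nat -> int) (w : Omega) : R :=
  \sum_(i < n) ((training w, Z (t i) w) \in B)%:R.

Lemma measurable_freq n t : measurable_fun setT (freq n t).
Proof.
apply: measurable_sum => i; apply: measurable_fun_mem => //.
by apply: measurable_fun_pair => //; exact: measurable_training.
Qed.

Lemma freq_add k l t w : freq (k + l) t w = freq k t w + freq l (fun i => t (k + i)%N) w.
Proof. by rewrite /freq big_split_ord. Qed.

Lemma freq_le n t w : freq n t w <= n%:R.
Proof.
apply: (@le_trans _ _ (\sum_(i < n) (1 : R))); last by rewrite sumr_const card_ord.
by apply: ler_sum => i _; case: (_ \in _) => /=.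
Qed.

(** For frozen [z], [hits_tail] applies to the section of [B] at [z], and [coupling_section]
    restores the training data. Observations start after time [ntr + c - 1], so [r <= c] provides
    the gap. *)
Lemma train_tail (a m r c : nat) (L e : R) :
  (0 < a)%N -> (0 < m)%N -> 0 < L -> (r <= c)%N ->
  e = sigma_tilde beta a * Num.sqrt (4 / (2 * m * a)%:R * L) + 1 / (3 * m%:R) * L ->
  pr P [set w | (2 * m * a)%:R * (section_pr (training w) + e)
               <= freq (2 * m * a) (fun i => Posz (ntr + c + i)) w]
  <= 2 * expR (- L) + 2 * (m - 1)%:R * beta a + beta r.
Proof.
move=> a0 m0 L0 rc ee.
set N := (2 * m * a)%N.
pose E := [set zv : ntr.-tuple T * N.-tuple T |
  N%:R * (section_pr zv.1 + e) <= \sum_(i < N) ((zv.1, tnth zv.2 i) \in B)%:R].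
have mE : measurable E.
  apply: measurable_set_ler.
    apply: measurable_funM => //; apply: measurable_funD => //.
    exact: (measurableT_comp measurable_section_pr).
  apply: measurable_sum => i; apply: measurable_fun_mem => //.
  apply: measurable_fun_pair => //.
  exact: (measurableT_comp (measurable_tnth i)).
have th (i : 'I_ntr) : Posz i.+1 <= Posz ntr by have := ltn_ord i; lia.
have hu (j : 'I_N) : Posz ntr + r%:Z <= Posz (ntr + c + j) by lia.
have fE w : freq N (fun i => Posz (ntr + c + i)) w =
    \sum_(i < N) ((training w, tnth (tup Z (fun j : 'I_N => Posz (ntr + c + j)) w) i) \in B)%:R.
  by apply: eq_bigr => i _; rewrite tnth_mktuple.
have := coupling_section mZ stZ th hu mE (kappa := 2 * expR (- L) + 2 * (m - 1)%:R * beta a).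
rewrite (_ : [set w | E _] = [set w | N%:R * (section_pr (training w) + e)
               <= freq N (fun i => Posz (ntr + c + i)) w]); last first.
  by apply/seteqP; split => w; rewrite /E/= fE.
apply => z.
have := hits_tail mZ stZ (measurable_xsection z mB) a0 (Posz (ntr + c)) m0 L0 ee.
have hE w : (hits Z (xsection B z) N (fun i => Posz (ntr + c) + i%:Z) w)%:R =
    \sum_(i < N) ((z, tnth (tup Z (fun j : 'I_N => Posz (ntr + c + j)) w) i) \in B)%:R :> R.
  by rewrite natr_sum; apply: eq_bigr => i _; rewrite tnth_mktuple mem_xsection.
have -> : pr P (Z 1 @^-1` xsection B z) = section_pr z.
  by congr (pr P _); apply/seteqP; split => w; rewrite /xsection/= inE.
by congr (pr P _ <= _); apply/seteqP; split => w; rewrite /E/= -/N hE.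
Qed.

Variables (sk tl : nat).

(* [off] counts the indices skipped after the training block; the [sk] first
   and [tl] last of the [n] observations are discarded to leave [2 m a]. *)
Lemma train_tail_trim (a m r off n : nat) (L e e' : R) :
  (0 < a)%N -> (0 < m)%N -> 0 < L -> (r <= off + sk)%N -> n = (sk + 2 * m * a + tl)%N ->
  e = sigma_tilde beta a * Num.sqrt (4 / (2 * m * a)%:R * L) + 1 / (3 * m%:R) * L ->
  (2 * m * a)%:R * e <= n%:R * e' ->
  pr P [set w | section_pr (training w) + (e' + (sk + tl)%:R / n%:R)
               <= n%:R^-1 * freq n (fun i => Posz (ntr + off + i)) w]
  <= 2 * expR (- L) + 2 * (m - 1)%:R * beta a + beta r.
Proof.
move=> a0 m0 L0 roff nE ee ee'.
have n0 : 0 < n%:R :> R by rewrite ltr0n nE; nia.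
apply: le_trans (train_tail a0 m0 L0 roff ee).
apply: le_pr.
- apply: measurable_set_ler.
    apply: measurable_funD => //; apply: (measurableT_comp measurable_section_pr).
    exact: measurable_training.
  by apply: measurable_funM => //; exact: measurable_freq.
- apply: measurable_set_ler; last exact: measurable_freq.
  apply: measurable_funM => //; apply: measurable_funD => //.
  by apply: (measurableT_comp measurable_section_pr); exact: measurable_training.
move=> w /=; rewrite ler_pdivlMl// => H.
set p := section_pr _ in H *.
have p0 : 0 <= p by exact: pr_ge0.
(* Discarded observations contribute at most [sk + tl] hits, which the extra term of the threshold
   absorbs; the threshold may also be lowered from [n p] to [2 m a p] because [p >= 0]. *)
have := freq_le sk (fun i => Posz (ntr + off + i)) w.
have := freq_le tl (fun i => Posz (ntr + off + (sk + 2 * m * a + i))) w.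
have := freq_add (sk + 2 * m * a) tl (fun i => Posz (ntr + off + i)) w.
rewrite -nE freq_add.
have -> : freq (2 * m * a) (fun i => Posz (ntr + off + (sk + i))) w =
  freq (2 * m * a) (fun i => Posz (ntr + (off + sk) + i)) w.
  by apply: eq_bigr => i _; congr ((nat_of_bool ((_, Z _ w) \in B))%:R); lia.
move=> HD Htl Hsk.
move: H; rewrite mulrDr mulrDr mulrCA divff ?gt_eqF// mulr1 natrD.
have nR : n%:R = sk%:R + (2 * m * a)%:R + tl%:R :> R by rewrite nE !natrD.
rewrite HD => H.
have : (2 * m * a)%:R * p <= n%:R * p by rewrite ler_wpM2r// nE ler_nat; lia.
lra.
Qed.

End train_tail.

(** * Deviation widths and attainment of their infima *)

Section widths.
Context {R : realType}.
Implicit Types (beta : nat -> R) (delta : R).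

Definition width_cal beta ncal delta (a m r : nat) : R :=
  sigma_tilde beta a * Num.sqrt (4 / (ncal - r + 1)%:R * Lcal beta delta a m r)
  + 1 / (3 * m%:R) * Lcal beta delta a m r + (r - 1)%:R / ncal%:R.

Definition width_test beta ncal ntest delta (a m s : nat) : R :=
  sigma_tilde beta a * Num.sqrt (4 / ntest%:R * Lcal beta delta a m ncal)
  + 1 / (3 * m%:R) * Lcal beta delta a m ncal + s%:R / ntest%:R.

Lemma Lcal_gt0 beta delta a m r : (forall j, 0 <= beta j) -> delta < 1 ->
  4 * (m - 1)%:R * beta a + beta r < delta -> 0 < Lcal beta delta a m r.
Proof.
move=> b0 d1 D; rewrite /Lcal ln_gt0// ltr_pdivlMr; last lra.
have : 0 <= 4 * (m - 1)%:R * beta a by rewrite !mulr_ge0.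
have := b0 r; lra.
Qed.

(** [expR (- L)] is a quarter of [delta - 4 (m - 1) beta a - beta r], so the left-hand side equals
    [(delta + beta r) / 2], and [beta r < delta]. *)
Lemma tail_le_delta beta delta a m r : (forall j, 0 <= beta j) ->
  4 * (m - 1)%:R * beta a + beta r < delta ->
  2 * expR (- Lcal beta delta a m r) + 2 * (m - 1)%:R * beta a + beta r <= delta.
Proof.
move=> b0 D; rewrite /Lcal expRN lnK ?posrE; last by apply: divr_gt0; lra.
rewrite invf_div.
have : 0 <= (m - 1)%:R * beta a by rewrite mulr_ge0.
have := b0 r; lra.
Qed.

Lemma width_cal_ge0 beta ncal delta a m r : 0 < Lcal beta delta a m r ->
  0 <= width_cal beta ncal delta a m r.
Proof. by move=> /ltW L0; rewrite /width_cal !addr_ge0 ?mulr_ge0 ?sqrtr_ge0. Qed.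

Lemma width_test_ge0 beta ncal ntest delta a m s : 0 < Lcal beta delta a m ncal ->
  0 <= width_test beta ncal ntest delta a m s.
Proof. by move=> /ltW L0; rewrite /width_test !addr_ge0 ?mulr_ge0 ?sqrtr_ge0. Qed.

(** Tail bounds hold for one fixed triple. As the feasible triples are finitely many, the infimum is
    attained and no limit has to be exchanged with a probability. *)
Lemma ereal_inf_min (K : nat) (F : nat -> nat -> nat -> Prop) (f : nat -> nat -> nat -> R) :
  (forall a m r, F a m r -> [/\ (a < K)%N, (m < K)%N & (r < K)%N]) ->
  (exists a m r, F a m r) ->
  exists a m r, F a m r /\
    ereal_inf [set v : \bar R | exists a m r, F a m r /\ v = (f a m r)%:E] = (f a m r)%:E.
Proof.
move=> bF [a0 [m0 [r0 F0]]].
pose I := ('I_K * 'I_K * 'I_K)%type.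
pose pF (i : I) := `[< F i.1.1 i.1.2 i.2 >].
have [aK mK rK] := bF _ _ _ F0.
pose i0 : I := (Ordinal aK, Ordinal mK, Ordinal rK).
have Fi0 : pF i0 by apply/asboolP.
case: (Order.TotalTheory.arg_minP (fun i : I => f i.1.1 i.1.2 i.2) Fi0) => i /asboolP Fi imin.
exists i.1.1, i.1.2, i.2; split => //; apply/eqP; rewrite eq_le; apply/andP; split.
  by apply: ereal_inf_lbound; exists i.1.1, i.1.2, i.2.
apply: le_ereal_inf_tmp => _ [a [m [r [Famr ->]]]].
have [aK' mK' rK'] := bF _ _ _ Famr.
rewrite lee_fin; apply: (imin (Ordinal aK', Ordinal mK', Ordinal rK')).
exact/asboolP.
Qed.

Lemma eps_cal_min beta ncal delta :
  eps_cal beta ncal delta = +oo%E \/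
  exists a m r, F_cal beta ncal delta a m r /\
    eps_cal beta ncal delta = (width_cal beta ncal delta a m r)%:E.
Proof.
have [ne|nF] := pselect (exists a m r, F_cal beta ncal delta a m r).
  (* Truncated subtraction does not let [r] escape: for [r >= ncal] the right-hand side of the
     constraint is 1, which is odd. *)
  right; apply: (@ereal_inf_min ncal.+2) => // a m r [a0 m0 r0 e _].
  by split; nia.
left; rewrite /eps_cal (_ : [set _ | _] = set0) ?ereal_inf0//.
by apply/seteqP; split => // v [a [m [r [Famr _]]]]; case: nF; exists a, m, r.
Qed.

Lemma eps_test_min beta ncal ntest delta :
  eps_test beta ncal ntest delta = +oo%E \/
  exists a m s, F_test beta ncal ntest delta a m s /\
    eps_test beta ncal ntest delta = (width_test beta ncal ntest delta a m s)%:E.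
Proof.
have [ne|nF] := pselect (exists a m s, F_test beta ncal ntest delta a m s).
  right; apply: (@ereal_inf_min ntest.+2) => // a m s [a0 m0 e _].
  by split; nia.
left; rewrite /eps_test (_ : [set _ | _] = set0) ?ereal_inf0//.
by apply/seteqP; split => // v [a [m [s [Famr _]]]]; case: nF; exists a, m, s.
Qed.

End widths.

(** * Upper and lower tails on the calibration and test blocks *)

Section two_sided_tails.
Context {R : realType} {d : measure_display} {Omega : measurableType d}.
Variable P : probability Omega R.
Context {dT : measure_display} {T : measurableType dT}.
Variable Z : int -> Omega -> T.
Hypothesis mZ : forall t, measurable_fun setT (Z t).
Hypothesis stZ : stationary P Z.
Variables (ntr ncal ntest : nat).
Hypotheses (ncal0 : (0 < ncal)%N) (ntest0 : (0 < ntest)%N).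

Local Notation beta := (beta_coef P Z).
Let beta0 j : 0 <= beta j. Proof. exact: beta_coef_ge0. Qed.

Definition index_cal (i : nat) : int := Posz (ntr + i.+1).
Definition index_test (i : nat) : int := Posz (ntr + ncal + i.+1).

Definition mean_cal (B : set (ntr.-tuple T * T)) w : R :=
  ncal%:R^-1 * freq Z B ncal index_cal w.
Definition mean_test (B : set (ntr.-tuple T * T)) w : R :=
  ntest%:R^-1 * freq Z B ntest index_test w.
Definition mass (B : set (ntr.-tuple T * T)) w : R := section_pr P Z B (training Z ntr w).

Lemma measurable_mean_cal B : measurable B -> measurable_fun setT (mean_cal B).
Proof. by move=> mB; apply: measurable_funM => //; exact: measurable_freq. Qed.

Lemma measurable_mean_test B : measurable B -> measurable_fun setT (mean_test B).
Proof. by move=> mB; apply: measurable_funM => //; exact: measurable_freq. Qed.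

Lemma measurable_mass B : measurable B -> measurable_fun setT (mass B).
Proof.
move=> mB; apply: (measurableT_comp (measurable_section_pr P mZ mB)).
exact: measurable_training.
Qed.

Let freqC n t (B : set (ntr.-tuple T * T)) w :
  freq Z (~` B) n t w = n%:R - freq Z B n t w :> R.
Proof.
rewrite /freq -[X in X%:R - _]card_ord -sumr_const -sumrB; apply: eq_bigr => i _.
by rewrite in_setC; case: (_ \in B); rewrite ?subrr ?subr0.
Qed.

Let massC B w : measurable B -> mass (~` B) w = 1 - mass B w.
Proof.
move=> mB; rewrite /mass /section_pr; set z := training _ _ _.
rewrite -pr_setC//.
have := mZ 1 measurableT (measurable_xsection z mB).
by rewrite setTI; congr measurable; apply/seteqP; split => w' /=; rewrite /xsection/= inE.
Qed.

(** The calibration block follows the training block immediately, so its first [r - 1] points are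
    sacrificed to open a gap of [r]; exactly [2 m a] points remain. *)
Lemma cal_upper B delta a m r : measurable B -> delta < 1 -> F_cal beta ncal delta a m r ->
  pr P [set w | mass B w + width_cal beta ncal delta a m r <= mean_cal B w] <= delta.
Proof.
move=> mB d1 [a0 m0 r0 Ne D].
have L0 := Lcal_gt0 beta0 d1 D.
apply: le_trans (tail_le_delta beta0 D).
have nE : ncal = ((r - 1) + 2 * m * a + 0)%N by nia.
have rE : (r <= 1 + (r - 1))%N by lia.
pose e := sigma_tilde beta a * Num.sqrt (4 / (2 * m * a)%:R * Lcal beta delta a m r)
  + 1 / (3 * m%:R) * Lcal beta delta a m r.
have e0 : 0 <= e.
  by rewrite addr_ge0 ?mulr_ge0 ?sqrtr_ge0// ltW.
have ee : (2 * m * a)%:R * e <= ncal%:R * e.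
  by rewrite ler_wpM2r// ler_nat; lia.
have := train_tail_trim mZ stZ mB a0 m0 L0 rE nE (erefl e) ee.
have fE w : freq Z B ncal (fun i => Posz (ntr + 1 + i)) w = freq Z B ncal index_cal w :> R.
  by apply: eq_bigr => i _; congr ((nat_of_bool ((_, Z _ w) \in B))%:R); rewrite /index_cal; lia.
by congr (pr P _ <= _); apply/seteqP; split => w /=;
  rewrite /mass /mean_cal /width_cal -Ne addn0 fE.
Qed.

(** The calibration block is the gap, and only the last [s] points are trimmed. The width has
    [ntest] under the root where the block bound has [2 m a]: this is legitimate because
    [x * sqrt (4 L / x) = sqrt (4 L x)] is nondecreasing in [x]. *)
Lemma test_upper B delta a m s : measurable B -> delta < 1 -> F_test beta ncal ntest delta a m s ->
  pr P [set w | mass B w + width_test beta ncal ntest delta a m s <= mean_test B w] <= delta.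
Proof.
move=> mB d1 [a0 m0 Ne D].
have L0 := Lcal_gt0 beta0 d1 D.
apply: le_trans (tail_le_delta beta0 D).
have nE : ntest = (0 + 2 * m * a + s)%N by nia.
have rE : (ncal <= ncal.+1 + 0)%N by lia.
set L := Lcal _ _ _ _ _ in L0 *.
pose e := sigma_tilde beta a * Num.sqrt (4 / (2 * m * a)%:R * L) + 1 / (3 * m%:R) * L.
pose e' := sigma_tilde beta a * Num.sqrt (4 / ntest%:R * L) + 1 / (3 * m%:R) * L.
have N0 : (0 < 2 * m * a)%N by rewrite !muln_gt0 m0.
have sq (x : R) : 0 < x -> x * Num.sqrt (4 / x * L) = Num.sqrt (4 * L * x).
  move=> x0; have -> : 4 * L * x = x ^+ 2 * (4 / x * L) by field; rewrite gt_eqF.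
  by rewrite [RHS]sqrtrM ?sqr_ge0// sqrtr_sqr gtr0_norm.
have ee : (2 * m * a)%:R * e <= ntest%:R * e'.
  rewrite /e /e' !mulrDr !(mulrCA _ (sigma_tilde _ _)) !sq ?ltr0n//.
  have Nn : (2 * m * a)%:R <= ntest%:R :> R by rewrite ler_nat; lia.
  apply: lerD.
    apply: ler_wpM2l; first exact: sqrtr_ge0.
    by apply: ler_wsqrtr; apply: ler_wpM2l => //; rewrite mulr_ge0 ?ltW.
  by apply: ler_wpM2r => //; rewrite mulr_ge0// ltW.
have := train_tail_trim mZ stZ mB a0 m0 L0 rE nE (erefl e) ee.
have fE w : freq Z B ntest (fun i => Posz (ntr + ncal.+1 + i)) w =
    freq Z B ntest index_test w :> R.
  by apply: eq_bigr => i _; congr ((nat_of_bool ((_, Z _ w) \in B))%:R); rewrite /index_test; lia.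
by congr (pr P _ <= _); apply/seteqP; split => w /=;
  rewrite /mass /mean_test /width_test add0n fE.
Qed.

(** The upper tail of the complement of [B]. *)
Lemma cal_lower B delta a m r : measurable B -> delta < 1 -> F_cal beta ncal delta a m r ->
  pr P [set w | mean_cal B w <= mass B w - width_cal beta ncal delta a m r] <= delta.
Proof.
move=> mB d1 H; have := cal_upper (measurableC mB) d1 H.
congr (pr P _ <= _); apply/seteqP; split => w /=;
  rewrite massC// /mean_cal freqC mulrBr mulVf ?pnatr_eq0 -?lt0n//; lra.
Qed.

Lemma test_lower B delta a m s : measurable B -> delta < 1 -> F_test beta ncal ntest delta a m s ->
  pr P [set w | mean_test B w <= mass B w - width_test beta ncal ntest delta a m s] <= delta.
Proof.
move=> mB d1 H; have := test_upper (measurableC mB) d1 H.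
congr (pr P _ <= _); apply/seteqP; split => w /=;
  rewrite massC// /mean_test freqC mulrBr mulVf ?pnatr_eq0 -?lt0n//; lra.
Qed.

End two_sided_tails.

(** * Coverage of split conformal prediction *)

Section conformal_coverage.
Context {R : realType} {d : measure_display} {Omega : measurableType d}.
Variable P : probability Omega R.
Context {d1 d2 : measure_display} {X : measurableType d1} {Y : measurableType d2}.
Variable Z : int -> Omega -> X * Y.
Hypothesis mZ : forall t, measurable_fun setT (Z t).
Hypothesis stZ : stationary P Z.
Variables (ntr ncal ntest : nat).
Hypotheses (ncal0 : (0 < ncal)%N) (ntest0 : (0 < ntest)%N).
Variable s : ntr.-tuple (X * Y) -> X * Y -> R.
Hypothesis ms : measurable_fun setT (fun p : ntr.-tuple (X * Y) * (X * Y) => s p.1 p.2).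
Variable phi : R.
Hypothesis phi01 : 0 < phi < 1.

Local Notation beta := (beta_coef P Z).
Local Notation train := (train_data Z ntr).
Local Notation cov := (test_coverage Z ntr ncal ntest s phi).

Definition below (w : Omega) (x : R) : R :=
  \sum_(i < ncal) (s_train Z ntr s w (Zcal Z ntr i w) < x)%R%:R.

(* The infimum defining [q_cal] is attained at a calibration score, so
   membership in the conformal set only depends on a rank. *)
Lemma conf_setE w x y :
  (y \in conf_set Z ntr ncal s phi w x) = (below w (s_train Z ntr s w (x, y)) < phi * ncal%:R).
Proof.
have /andP[phi0 _] := phi01.
have nR : 0 < ncal%:R :> R by rewrite ltr0n.
set c := fun i : 'I_ncal => s_train Z ntr s w (Zcal Z ntr i w).
set v := s_train Z ntr s w (x, y).
apply/idP/idP => [/set_mem|h].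
  rewrite /conf_set/= -/v /q_cal => vq; rewrite ltNge; apply/negP => h.
  have [i0 ci0] : exists i, c i < v.
    apply/not_existsP => H.
    move: h; rewrite /below big1 => [|i _]; first by rewrite leNgt mulr_gt0.
    by have /negP := H i; rewrite -/(c i) => /negbTE ->.
  (* The largest calibration score below [v] already reaches the level [phi], so the infimum is at
     most [c j < v]. *)
  pose j := [arg max_(i > i0 | c i < v) c i]%O.
  have [cj jmax] : c j < v /\ (forall i, c i < v -> c i <= c j).
    by rewrite /j; case: Order.TotalTheory.arg_maxP => // k ck kmax; split.
  have : (ereal_inf [set t%:E | t in [set t : R |
     (phi <= ncal%:R^-1 * \sum_(i < ncal) (c i <= t)%R%:R)%R]] <= (c j)%:E)%E.
    apply: ereal_inf_lbound; exists (c j) => //=.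
    rewrite ler_pdivlMl// mulrC; apply: (le_trans h).
    apply: ler_sum => i _; rewrite ler_nat -/(c i).
    by case: (ltP (c i) v) => // /jmax ->.
  by move/(le_trans vq); rewrite lee_fin leNgt cj.
apply/mem_set; rewrite /conf_set/= -/v /q_cal.
apply: le_ereal_inf_tmp => _ [t /= + <-]; rewrite ler_pdivlMl// mulrC => H.
rewrite lee_fin leNgt; apply/negP => tv.
move: (lt_le_trans h H); apply/negP; rewrite -leNgt.
apply: ler_sum => i _; rewrite ler_nat -/(c i).
by case: (leP (c i) t) => // /le_lt_trans /(_ tv) ->.
Qed.

Lemma coverageE w :
  cov w = ntest%:R^-1 * \sum_(i < ntest)
    (below w (s_train Z ntr s w (Ztest Z ntr ncal i w)) < phi * ncal%:R)%R%:R.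
Proof.
congr (_ * _); apply: eq_bigr => i _.
by rewrite conf_setE -surjective_pairing.
Qed.

Lemma coverage_ge0 w : 0 <= cov w.
Proof. by rewrite mulr_ge0 ?invr_ge0// sumr_ge0. Qed.

Lemma coverage_le1 w : cov w <= 1.
Proof.
rewrite /test_coverage ler_pdivrMl ?ltr0n// mulr1.
apply: (@le_trans _ _ (\sum_(i < ntest) (1 : R))); last by rewrite sumr_const card_ord.
by apply: ler_sum => i _; case: (_ \in _).
Qed.

Let measurable_score t : measurable_fun setT (fun w => s_train Z ntr s w (Z t w)).
Proof.
apply: (measurableT_comp ms (g := fun w => (train w, Z t w))).
by apply: measurable_fun_pair => //; exact: measurable_training.
Qed.

Let measurable_ltr_nat (f g : Omega -> R) : measurable_fun setT f -> measurable_fun setT g ->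
  measurable_fun setT (fun w => (f w < g w)%R%:R : R).
Proof.
move=> mf mg.
have := measurable_fun_mem (R := R) (measurable_set_ltr mf mg) (@measurable_id _ Omega setT).
apply: eq_measurable_fun => w _; congr ((nat_of_bool _)%:R).
by apply/idP/idP => [/set_mem|/mem_set].
Qed.

Lemma measurable_coverage : measurable_fun setT cov.
Proof.
rewrite (_ : cov = fun w => ntest%:R^-1 * \sum_(i < ntest)
    (below w (s_train Z ntr s w (Ztest Z ntr ncal i w)) < phi * ncal%:R)%R%:R); last first.
  by apply/funext => w; exact: coverageE.
apply: measurable_funM => //; apply: measurable_sum => i.
apply: measurable_ltr_nat => //; apply: measurable_sum => j.
by apply: measurable_ltr_nat; exact: measurable_score.
Qed.

Section threshold.
Variable psi : R.
Hypothesis psi01 : 0 < psi < 1.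

Let q (z : ntr.-tuple (X * Y)) := quantile P (fun w => s z (Z 1 w)) psi.

(** Two sets, because the score may have an atom at its quantile: in general the strict one has mass
    at most [psi] and the large one mass at least [psi]. *)
Definition sub_quantile : set (ntr.-tuple (X * Y) * (X * Y)) := [set p | s p.1 p.2 < q p.1].
Definition to_quantile : set (ntr.-tuple (X * Y) * (X * Y)) := [set p | s p.1 p.2 <= q p.1].

Let measurable_s z : measurable_fun setT (fun w => s z (Z 1 w)).
Proof. by apply: (measurableT_comp ms (g := fun w => (z, Z 1 w))); exact: measurable_fun_pair. Qed.

(** By [quantileP], [r < q z] means that the mass of the scores at most [r] is below [psi], a
    measurable condition on [z]. *)
Let measurable_q : measurable_fun setT q.
Proof.
apply: (measurability (@RGenOInfty.G R)) => [|/= _ [_] [r] -> <-].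
  exact: RGenOInfty.measurableE.
pose B := [set p : ntr.-tuple (X * Y) * (X * Y) | s p.1 p.2 <= r].
have mB : measurable B by exact: measurable_set_ler.
rewrite setTI (_ : _ @^-1` _ = [set z | section_pr P Z B z < psi]).
  by apply: measurable_set_ltr => //; exact: measurable_section_pr.
have e z : (r < q z) = (section_pr P Z B z < psi).
  by rewrite ltNge (quantileP P (measurable_s z) psi01) -ltNge.
by apply/seteqP; split => z; rewrite /= in_itv/= andbT e.
Qed.

Lemma measurable_sub_quantile : measurable sub_quantile.
Proof. by apply: measurable_set_ltr => //; exact: (measurableT_comp measurable_q). Qed.

Lemma measurable_to_quantile : measurable to_quantile.
Proof. by apply: measurable_set_ler => //; exact: (measurableT_comp measurable_q). Qed.

Lemma mass_sub_quantile w : mass P Z sub_quantile w <= psi.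
Proof. by apply: pr_lt_quantile => //; exact: measurable_s. Qed.

Lemma mass_to_quantile w : psi <= mass P Z to_quantile w.
Proof.
have mX := measurable_s (training Z ntr w).
by rewrite -(quantileP P mX psi01 (q (training Z ntr w))).
Qed.

Lemma mass_to_quantile_continuous w :
  (forall t : R, P [set w' | s_train Z ntr s w (Z 1 w') = t] = 0%E) ->
  mass P Z to_quantile w <= psi.
Proof.
move=> H; pose z := train w.
pose A := [set w' | s z (Z 1 w') < q z]; pose A' := [set w' | s z (Z 1 w') = q z].
have mA : measurable A by exact: measurable_set_ltr.
have mA' : measurable A'.
  rewrite (_ : A' = [set w' | s z (Z 1 w') <= q z] `&` [set w' | q z <= s z (Z 1 w')]).
    by apply: measurableI; exact: measurable_set_ler.
  apply/seteqP; split => w'; rewrite /A'/=; first by move=> ->.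
  by move=> [h1 h2]; apply/eqP; rewrite eq_le h1 h2.
have -> : mass P Z to_quantile w = pr P (A `|` A').
  congr (pr P _); apply/seteqP; split => w'; rewrite /to_quantile /A /A' /= -/(train w) -/z.
    by rewrite le_eqVlt => /orP[/eqP ->|->]; [right|left].
  by case=> [/ltW|->].
apply: (le_trans (pr_setU_le P mA mA')).
rewrite [pr P A'](_ : _ = 0) ?addr0; first exact: mass_sub_quantile.
by rewrite /pr (H (q z)).
Qed.

Let mean_calE (B : set (ntr.-tuple (X * Y) * (X * Y))) w :
  mean_cal Z ncal B w = ncal%:R^-1 * \sum_(i < ncal) ((train w, Zcal Z ntr i w) \in B)%:R :> R.
Proof. by []. Qed.

Let mean_testE (B : set (ntr.-tuple (X * Y) * (X * Y))) w :
  mean_test Z ncal ntest B w =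
  ntest%:R^-1 * \sum_(i < ntest) ((train w, Ztest Z ntr ncal i w) \in B)%:R :> R.
Proof. by []. Qed.

(** A test score at most [q] has no more calibration scores strictly below it than [q] has, that is,
    fewer than [phi * ncal]; by [conf_setE] the point is covered. *)
Lemma mean_test_le_coverage w : mean_cal Z ncal sub_quantile w < phi ->
  mean_test Z ncal ntest to_quantile w <= cov w.
Proof.
rewrite mean_calE mean_testE coverageE ltr_pdivrMl ?ltr0n// [_ * phi]mulrC => H.
rewrite ler_wpM2l ?invr_ge0//; apply: ler_sum => i _; rewrite ler_nat.
case: (boolP (_ \in to_quantile)) => // /set_mem; rewrite /to_quantile/= => h.
rewrite (le_lt_trans _ H)//; apply: ler_sum => j _; rewrite ler_nat.
case: ltP => // h2; rewrite (mem_set _)//.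
exact: lt_le_trans h2 h.
Qed.

(** A test score above [q] exceeds all calibration scores at most [q], of which there are at least
    [phi * ncal]; by [conf_setE] the point is not covered. *)
Lemma coverage_le_mean_test w : phi <= mean_cal Z ncal to_quantile w ->
  cov w <= mean_test Z ncal ntest to_quantile w.
Proof.
rewrite mean_calE mean_testE coverageE ler_pdivlMl ?ltr0n// [_ * phi]mulrC => H.
rewrite ler_wpM2l ?invr_ge0//; apply: ler_sum => i _; rewrite ler_nat.
case: (boolP (_ \in to_quantile)) => [_|/negP h]; first by case: (_ < _).
case: ltP => //; rewrite ltNge => /negP; case; apply: (le_trans H).
apply: ler_sum => j _; rewrite ler_nat.
case: (boolP (_ \in to_quantile)) => // /set_mem h2.
suff -> : s_train Z ntr s w (Zcal Z ntr j w) < s_train Z ntr s w (Ztest Z ntr ncal i w) by [].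
apply: (le_lt_trans h2); rewrite /= ltNge; apply/negP => h3; apply: h; exact/mem_set.
Qed.

End threshold.

Section failure_probability.
Variables (delta_cal delta_test : R) (a m r a' m' r' : nat).
Hypotheses (delta_cal1 : delta_cal < 1) (delta_test1 : delta_test < 1).
Hypothesis Fcal : F_cal beta ncal delta_cal a m r.
Hypothesis Ftest : F_test beta ncal ntest delta_test a' m' r'.

Let wc := width_cal beta ncal delta_cal a m r.
Let wt := width_test beta ncal ntest delta_test a' m' r'.

Let beta0 j : 0 <= beta j. Proof. exact: beta_coef_ge0. Qed.

Let wc0 : 0 <= wc.
Proof. by case: Fcal => _ _ _ _ D; apply: width_cal_ge0; exact: Lcal_gt0. Qed.

Let wt0 : 0 <= wt.
Proof. by case: Ftest => _ _ _ D; apply: width_test_ge0; exact: Lcal_gt0. Qed.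

Let dc0 : 0 <= delta_cal.
Proof.
apply: le_trans (cal_upper (ntr := ntr) mZ stZ ncal0 ntest0 measurableT delta_cal1 Fcal).
exact: pr_ge0.
Qed.

Let dt0 : 0 <= delta_test.
Proof.
apply: le_trans (test_upper (ntr := ntr) mZ stZ ncal0 ntest0 measurableT delta_test1 Ftest).
exact: pr_ge0.
Qed.

Let measurable_gap_cal (B : set (ntr.-tuple (X * Y) * (X * Y))) (e : R) : measurable B ->
  measurable [set w | mass P Z B w + e <= mean_cal Z ncal B w] /\
  measurable [set w | mean_cal Z ncal B w <= mass P Z B w - e].
Proof.
move=> mB; have h1 := measurable_mass P mZ mB.
split; apply: measurable_set_ler; first exact: measurable_funD.
- exact: measurable_mean_cal.
- exact: measurable_mean_cal.
- exact: measurable_funB.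
Qed.

Let measurable_gap_test (B : set (ntr.-tuple (X * Y) * (X * Y))) (e : R) : measurable B ->
  measurable [set w | mass P Z B w + e <= mean_test Z ncal ntest B w] /\
  measurable [set w | mean_test Z ncal ntest B w <= mass P Z B w - e].
Proof.
move=> mB; have h1 := measurable_mass P mZ mB.
split; apply: measurable_set_ler; first exact: measurable_funD.
- exact: measurable_mean_test.
- exact: measurable_mean_test.
- exact: measurable_funB.
Qed.

(** At level [phi - wc], outside the two bad events, the calibration mean of [sub_quantile] is below
    [phi - wc + wc = phi], so the coverage dominates the test mean of [to_quantile], which exceeds
    [phi - wc - wt]. *)
Lemma coverage_lower_tail :
  pr P [set w | cov w < phi - (wc + wt)] <= delta_cal + delta_test.
Proof.
(* A level at most 0 is not admissible for the quantile, but then the event is empty since coverage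
   is nonnegative. *)
have [psi0|psi0] := leP (phi - wc) 0.
  rewrite (_ : [set w | _] = set0); first by rewrite /pr measure0 addr_ge0.
  by apply/seteqP; split => // w /=; have := coverage_ge0 w; have := wt0; lra.
have /andP[_ phi1] := phi01.
have psi01 : 0 < phi - wc < 1 by rewrite psi0/=; have := wc0; lra.
have m1 := measurable_sub_quantile psi01; have m2 := measurable_to_quantile psi01.
have mA1 := (measurable_gap_cal wc m1).1; have mA2 := (measurable_gap_test wt m2).2.
apply: le_trans (lerD (cal_upper mZ stZ ncal0 ntest0 m1 delta_cal1 Fcal)
  (test_lower mZ stZ ncal0 ntest0 m2 delta_test1 Ftest)).
apply: le_trans (pr_setU_le P mA1 mA2).
apply: le_pr; [|exact: measurableU|].
  by apply: measurable_set_ltr => //; exact: measurable_coverage.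
move=> w /= cw; apply: contrapT => /not_orP[/negP + /negP]; rewrite -!ltNge => h1 h2.
have := mass_sub_quantile psi01 w; have := mass_to_quantile psi01 w.
have := @mean_test_le_coverage (phi - wc) w.
rewrite -/wc -/wt in h1 h2.
move=> H M2 M1.
have /H H' : mean_cal Z ncal (sub_quantile (phi - wc)) w < phi by lra.
lra.
Qed.

(** The mirror image at level [phi + wc], with [to_quantile] in both means. Its mass must now be
    bounded on both sides: at least the level for the calibration mean, at most the level for the
    test mean; the latter is where continuity enters. *)
Lemma coverage_upper_tail :
  {ae P, forall w, forall t : R, P [set w' | s_train Z ntr s w (Z 1 w') = t] = 0%E} ->
  pr P [set w | phi + (wc + wt) < cov w] <= delta_cal + delta_test.
Proof.
move=> [N [mN N0 subN]].
have [psi1|psi1] := leP 1 (phi + wc).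
  rewrite (_ : [set w | _] = set0); first by rewrite /pr measure0 addr_ge0.
  by apply/seteqP; split => // w /=; have := coverage_le1 w; have := wt0; lra.
have /andP[phi0 _] := phi01.
have psi01 : 0 < phi + wc < 1 by rewrite psi1 andbT; have := wc0; lra.
have m2 := measurable_to_quantile psi01.
have mA1 := (measurable_gap_cal wc m2).2; have mA2 := (measurable_gap_test wt m2).1.
apply: le_trans (lerD (cal_lower mZ stZ ncal0 ntest0 m2 delta_cal1 Fcal)
  (test_upper mZ stZ ncal0 ntest0 m2 delta_test1 Ftest)).
apply: le_trans (pr_setU_le P mA1 mA2).
have mA := measurableU _ _ mA1 mA2.
have := pr_setU_le P mA mN; rewrite [pr P N](_ : _ = 0) ?addr0; last by rewrite /pr N0.
apply: le_trans.
apply: le_pr; [|exact: measurableU|].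
  by apply: measurable_set_ltr => //; exact: measurable_coverage.
move=> w /= cw.
have [wN|wN] := pselect (N w); [by right|left].
apply: contrapT => /not_orP[/negP + /negP]; rewrite -!ltNge => h1 h2.
have cont : forall t : R, P [set w' | s_train Z ntr s w (Z 1 w') = t] = 0%E.
  by apply/not_notP => h; apply: wN; exact: subN.
have := mass_to_quantile_continuous psi01 cont; have := mass_to_quantile psi01 w.
rewrite -/wc -/wt in h1 h2.
have := @coverage_le_mean_test (phi + wc) w.
move=> H M2 M1.
have /H H' : phi <= mean_cal Z ncal (to_quantile (phi + wc)) w by lra.
by have := lt_trans cw (le_lt_trans H' h2); rewrite addrA ltrD2r ltNge M1.
Qed.

End failure_probability.

End conformal_coverage.

Theorem theorem3p2 (R : realType) (d : measure_display) (Omega : measurableType d)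
  (P : probability Omega R) (d1 d2 : measure_display)
  (X : measurableType d1) (Y : measurableType d2)
  (Z : int -> Omega -> X * Y) (ntr ncal ntest : nat)
  (s : ntr.-tuple (X * Y) -> X * Y -> R) (alpha delta_cal delta_test : R) :
  (forall t : int, measurable_fun setT (Z t)) ->
  stationary P Z ->
  beta_mixing P Z ->
  (0 < ntr)%N -> (0 < ncal)%N -> (0 < ntest)%N ->
  measurable_fun setT (fun p : ntr.-tuple (X * Y) * (X * Y) => s p.1 p.2) ->
  0 < alpha < 1 -> 0 < delta_cal -> 0 < delta_test ->
  let beta := beta_coef P Z in
  let eta := (eps_cal beta ncal delta_cal + eps_test beta ncal ntest delta_test)%E in
  let cov := test_coverage Z ntr ncal ntest s (1 - alpha) in
  ((1 - delta_cal - delta_test)%:E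
     <= P [set w | ((1 - alpha)%:E - eta <= (cov w)%:E)%E])%E
  /\
  (
   {ae P, forall w, forall t : R,
      P [set w' | s_train Z ntr s w (Z 1 w') = t] = 0%E} ->
   ((1 - 2 * delta_cal - 2 * delta_test)%:E
     <= P [set w | ((`|cov w - (1 - alpha)|)%:E <= eta)%E])%E).
Proof.
move=> mZ stZ _ _ ncal0 ntest0 ms alpha01 dc0 dt0 beta eta cov.
have phi01 : 0 < 1 - alpha < 1 by lra.
have mcov : measurable_fun setT cov by exact: measurable_coverage.
(* If the deltas sum to at least 1, both lower bounds are at most 0. Otherwise each delta is below
   1, which makes the logarithms positive. *)
have [dge|dlt] := leP 1 (delta_cal + delta_test).
  split=> [|_]; apply: (@le_trans _ _ 0%E); rewrite ?measure_ge0// lee_fin; lra.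
have dc1 : delta_cal < 1 by lra.
have dt1 : delta_test < 1 by lra.
have trivial_bounds : eta = +oo%E ->
    ((1 - delta_cal - delta_test)%:E
     <= P [set w | ((1 - alpha)%:E - eta <= (cov w)%:E)%E])%E /\
    ((1 - 2 * delta_cal - 2 * delta_test)%:E
     <= P [set w | ((`|cov w - (1 - alpha)|)%:E <= eta)%E])%E.
  move=> ->.
  rewrite (_ : [set w | _] = setT); last by apply/seteqP; split => // w _ /=; rewrite leNye.
  rewrite (_ : [set w | (_ <= +oo)%E] = setT); last first.
    by apply/seteqP; split => // w _ /=; rewrite leey.
  by rewrite probability_setT !lee_fin; split; lra.
have [etaE|[a [m [r [Fc cE]]]]] := eps_cal_min beta ncal delta_cal.
  suff /trivial_bounds[] : eta = +oo%E by [].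
  (* [+oo + -oo] is [-oo], so [eps_test = -oo] has to be excluded; the dichotomy of [eps_test_min]
     does it. *)
  rewrite /eta etaE; have [->//|[a [m [r [_ ->]]]]//] := eps_test_min beta ncal ntest delta_test.
have [etaE|[a' [m' [r' [Ft tE]]]]] := eps_test_min beta ncal ntest delta_test.
  by suff /trivial_bounds[] : eta = +oo%E by []; rewrite /eta etaE cE.
pose e := width_cal beta ncal delta_cal a m r + width_test beta ncal ntest delta_test a' m' r'.
have etaE : eta = e%:E by rewrite /eta cE tE.
pose low := [set w | cov w < 1 - alpha - e].
pose high := [set w | 1 - alpha + e < cov w].
have mlow : measurable low by exact: measurable_set_ltr.
have mhigh : measurable high by exact: measurable_set_ltr.
have plow : pr P low <= delta_cal + delta_test.
  exact: (coverage_lower_tail mZ stZ ncal0 ntest0 ms phi01 dc1 dt1 Fc Ft).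
split.
  rewrite (_ : [set w | _] = ~` low); last first.
    apply/seteqP; split => w; rewrite /low/= etaE -EFinB lee_fin.
      by rewrite leNgt => /negP.
    by move/negP; rewrite -leNgt.
  by rewrite prE ?lee_fin ?pr_setC//; [lra|exact: measurableC].
move=> cont.
have phigh : pr P high <= delta_cal + delta_test.
  exact: (coverage_upper_tail mZ stZ ncal0 ntest0 ms phi01 dc1 dt1 Fc Ft).
(* The union bound over the two one-sided failures doubles the deltas. *)
rewrite (_ : [set w | _] = ~` (low `|` high)); last first.
  apply/seteqP; split => w; rewrite /low /high/= etaE lee_fin ler_norml.
    by move=> /andP[h1 h2] [h|h]; lra.
  by move=> /not_orP[/negP + /negP]; rewrite -!leNgt => h1 h2; lra.
have mU := measurableU _ _ mlow mhigh.
rewrite prE ?lee_fin ?pr_setC//; last exact: measurableC.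
by have := pr_setU_le P mlow mhigh; lra.
Qed.
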